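(* Let $(\Omega,\mathcal{A},\mu)$ be a complete finite measure space, let $\varphi\in\Delta_2$ be a Young function, let $\{\mathcal{A}_n\}_{n\in\mathbb{N}}$ be a sequence of $\sigma$-subalgebras of $\mathcal{A}$ and let $\mathfrak{D}$ be a $\sigma$-subalgebra of $\mathcal{A}$. Then $\mathcal{A}_n\xrightarrow{\mu\perp}\mathfrak{D}$ if and only if for every $f\in L^{\varphi}(\mathcal{A})$, $$\lim_{n\to\infty}\|E(f\mid\mathcal{A}_n)-E(f\mid\mathfrak{D})\|_{\varphi}=0.$$
   Context: A Young function is a continuous convex function $\varphi:\mathbb{R}\to\mathbb{R}$ that is even, satisfies $\varphi(x)=0$ if and only if $x=0$, and satisfies $\lim_{x\to\infty}\varphi(x)/x=\infty$ and $\lim_{x\to\infty}\varphi(x)=\infty$. Its complementary Young function is $\psi(y)=\sup\{x|y|-\varphi(x):x\ge 0\}$. We write $\varphi\in\Delta_2$ if there are constants $k>0$, $x_0>0$ with $\varphi(2x)\le k\varphi(x)$ for all $x\ge x_0$. The Orlicz space $L^{\varphi}(\mathcal{A})=L^{\varphi}(\Omega,\mathcal{A},\mu)$ is the space of (a.e. classes of) real-valued $\mathcal{A}$-measurable $f$ with $\int_\Omega\varphi(\alpha f)\,d\mu<\infty$ for some $\alpha>0$, with norm $\|f\|_\varphi=N_\varphi(f)=\inf\{k>0:\int_\Omega\varphi(|f|/k)\,d\mu\le 1\}$. For a $\sigma$-subalgebra $\mathfrak{D}\subseteq\mathcal{A}$, $E(f\mid\mathfrak{D})$ is the a.e. unique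 $\mathfrak{D}$-measurable function with $\int_D f\,d\mu=\int_D E(f\mid\mathfrak{D})\,d\mu$ for all $D\in\mathfrak{D}$; put $E_{\mathfrak{D}}^{\perp}(f)=f-E(f\mid\mathfrak{D})$. $\mu$-convergence: $\mathcal{A}_n\xrightarrow{\mu}\mathfrak{D}$ means that for every $D\in\mathfrak{D}$ there is a sequence $A_n\in\mathcal{A}_n$ with $\lim_n\mu(A_n\Delta D)=0$. Orthogonal convergence (in $L^\varphi(\mathcal{A})$): $\mathcal{A}_n\xrightarrow{\perp}\mathfrak{D}$ means that for every sequence $\{A_n\}$ with $A_n\in\mathcal{A}_n$ one has $E_{\mathfrak{D}}^{\perp}(\chi_{A_n})\to 0$ weakly in $L^{\varphi}(\mathcal{A})$; since $\varphi\in\Delta_2$ gives $(L^{\varphi})^*=L^{\psi}$, this means $\int_\Omega E_{\mathfrak{D}}^{\perp}(\chi_{A_n})\,g\,d\mu\to 0$ for every $g\in L^{\psi}(\mathcal{A})$. $\mathcal{A}_n\xrightarrow{\mu\perp}\mathfrak{D}$ means that both $\mathcal{A}_n\xrightarrow{\mu}\mathfrak{D}$ and $\mathcal{A}_n\xrightarrow{\perp}\mathfrak{D}$. *)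

(* Defs.v *)
From HB Require Import structures.
From mathcomp Require Import all_boot all_order all_algebra.
From mathcomp Require Import all_classical all_reals all_analysis.

Set Implicit Arguments.
Unset Strict Implicit.
Unset Printing Implicit Defensive.

Import Order.TTheory GRing.Theory Num.Theory.
Import numFieldNormedType.Exports.

Local Open Scope classical_set_scope.
Local Open Scope ring_scope.

Section young.
Context {R : realType}.
Implicit Type phi : R -> R.

Record young_function phi : Prop := YoungFunction {
  young_continuous : continuous phi ;
  young_convex : convex_function (setT : set (convex_lmodType R^o)) phi ;
  young_even : forall x, phi (- x) = phi x ;
  young_eq0 : forall x, phi x = 0 <-> x = 0 ;
  young_superlinear : phi x / x @[x --> +oo] --> +oo ;
  young_cvgy : phi x @[x --> +oo] --> +oo }.

Definition complementary phi (y : R) : R :=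
  sup [set x * `|y| - phi x | x in [set x | 0 <= x]].

Definition Delta2 phi : Prop :=
  exists k x0 : R, [/\ 0 < k, 0 < x0 &
    forall x, x0 <= x -> phi (2 * x) <= k * phi x].

End young.

Section orlicz.
Context {d : measure_display} {T : measurableType d} {R : realType}.
Variable mu : {measure set T -> \bar R}.
Implicit Types (phi : R -> R) (f g : T -> R).

(* Functions rather than classes modulo a.e. equality. *)
Definition orlicz_space phi : set (T -> R) :=
  [set f | measurable_fun setT f /\
    exists2 a : R, 0 < a & (\int[mu]_x (phi (a * f x))%:E < +oo)%E].

(* Extended-real valued, so that the norm of a function outside the Orlicz
   space is +oo (the infimum of an empty set). *)
Definition luxemburg_norm phi f : \bar R :=
  ereal_inf (EFin @` [set k : R | 0 < k /\
    (\int[mu]_x (phi (`|f x| / k))%:E <= 1)%E]).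

End orlicz.

Section conditional_expectation.
Context {d : measure_display} {T : measurableType d} {R : realType}.
Variable mu : {measure set T -> \bar R}.
Implicit Types (G D : set (set T)) (f g : T -> R).

Definition sigma_subalgebra G : Prop :=
  sigma_algebra setT G /\ G `<=` measurable.

Definition is_condexp G f g : Prop :=
  [/\ measurable_fun setT (g : g_sigma_algebraType G -> R),
      mu.-integrable setT (EFin \o g) &
      forall B, G B ->
        (\int[mu]_(x in B) (f x)%:E = \int[mu]_(x in B) (g x)%:E)%E].

(* A chosen version; for mu finite, f integrable and G a sigma-subalgebra,
   versions exist and agree almost everywhere. *)
Definition condexp G f : T -> R := xget (cst 0) [set g | is_condexp G f g].

Definition condexp_perp G f : T -> R := f \- condexp G f.

End conditional_expectation.

Section convergence.
Context {d : measure_display} {T : measurableType d} {R : realType}.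
Variable mu : {measure set T -> \bar R}.
Implicit Types (An : nat -> set (set T)) (D : set (set T)).

Definition mu_convergence An D : Prop :=
  forall B, D B -> exists2 A : nat -> set T, (forall n, An n (A n)) &
    mu (A n `+` B) @[n --> \oo] --> 0%E.

(* Weak convergence in the Orlicz space of phi, whose dual is, for phi in
   Delta_2, the Orlicz space of the complementary function. *)
Definition orthogonal_convergence (phi : R -> R) An D : Prop :=
  forall A : nat -> set T, (forall n, An n (A n)) ->
  forall g : T -> R, orlicz_space mu (complementary phi) g ->
    (\int[mu]_x (condexp_perp mu D \1_(A n) x * g x)%:E)%E
      @[n --> \oo] --> 0%E.

Definition mu_orthogonal_convergence (phi : R -> R) An D : Prop :=
  mu_convergence An D /\ orthogonal_convergence phi An D.

End convergence.

(* Main.v *)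
Require Import Defs.
From HB Require Import structures.
From mathcomp Require Import all_boot all_order all_algebra.
From mathcomp Require Import all_classical all_reals all_analysis.
From mathcomp Require Import measurable_realfun ring lra.

Set Implicit Arguments.
Unset Strict Implicit.
Unset Printing Implicit Defensive.

Import Order.TTheory GRing.Theory Num.Theory.
Import numFieldNormedType.Exports.

Local Open Scope classical_set_scope.
Local Open Scope ring_scope.

(* Everything reduces to L^1.  Under Delta_2 a function of L^phi is
   approximated in modular by its truncations, and by the integrated Jensen
   inequality the remainder stays small after conditioning, uniformly in n; on
   uniformly bounded functions phi is dominated by a multiple of the absolute
   value.

   For bounded f, write f = u + f0 with u = E(f | D).  For u, approximate by
   combinations of indicators of sets B of D: if 1_(A_n) -> 1_B in L^1, A_n in
   the n-th algebra, then E(1_B | A_n) is L^1-close to 1_(A_n), hence to 1_B.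
   For f0, whose conditional expectation on D vanishes, take A_n to be the set
   where w_n = E(f0 | A_n) is nonnegative: the integral of the positive part of
   w_n is that of 1_(A_n) f0 = (1_(A_n) - E(1_(A_n) | D)) f0, which tends to 0 by
   orthogonal convergence.

   Conversely, norm convergence implies L^1 convergence.  For B in D the sets
   A_n = {E(1_B | A_n) >= 1/2} approximate B.  For g in L^psi, which is
   integrable, truncate g; for bounded g self-adjointness of the conditional
   expectation turns the pairing of E^perp(1_(A_n)) with g into the integral over
   A_n of E(g | A_n) - E(g | D). *)

(** * Measurability with respect to a sub-sigma-algebra *)

Section subalgebra.
Context {d : measure_display} {T : measurableType d} {R : realType}.
Implicit Types (G : set (set T)) (f g h : T -> R).

Definition sub_measurable G g :=
  measurable_fun setT (g : g_sigma_algebraType G -> R).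

(** [g_sigma_algebraType G] carries the sigma-algebra generated by [G], and a sigma-algebra
    generates itself. *)
Lemma measurable_subalgebra G (B : set T) : sigma_subalgebra G ->
  @measurable _ (g_sigma_algebraType G) B <-> G B.
Proof.
move=> [sG _].
by rewrite -[X in X B <-> _]/(<<s G >>) sigma_algebra_id.
Qed.

Lemma subalgebra_measurable G (B : set T) : sigma_subalgebra G ->
  G B -> measurable B.
Proof. by move=> [_]; apply. Qed.

Lemma sub_measurable_measurable G g : sigma_subalgebra G ->
  sub_measurable G g -> measurable_fun setT g.
Proof.
move=> sG mg _ Y mY; apply: (subalgebra_measurable sG).
by apply/measurable_subalgebra => //; exact: mg.
Qed.

Lemma measurable_id_subalgebra G : sigma_subalgebra G ->
  measurable_fun setT (id : T -> g_sigma_algebraType G).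
Proof.
move=> sG _ Y /(measurable_subalgebra _ sG) GY.
by rewrite setTI preimage_id; exact: subalgebra_measurable GY.
Qed.

Lemma sub_measurable_indic G (B : set T) : sigma_subalgebra G ->
  G B -> sub_measurable G \1_B.
Proof.
move=> sG GB; apply: measurable_indic.
exact/measurable_subalgebra.
Qed.

Lemma sub_measurable_ge G g a : sigma_subalgebra G ->
  sub_measurable G g -> G [set x | a <= g x].
Proof.
move=> sG mg; apply/(measurable_subalgebra _ sG).
have := mg measurableT [set` `[a, +oo[] (measurable_itv _).
by rewrite setTI; congr (measurable _); apply/seteqP; split=> x /=;
  rewrite in_itv/= andbT.
Qed.

End subalgebra.

(** * Integrable real-valued functions on a finite measure space *)

Section integrable_api.
Context {d : measure_display} {T : measurableType d} {R : realType}.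
Variable mu : {finite_measure set T -> \bar R}.
Implicit Types (f g h : T -> R).

Definition Rintegrable f := mu.-integrable setT (EFin \o f).

Lemma Rintegrable_measurable f : Rintegrable f -> measurable_fun setT f.
Proof. by move=> /measurable_int /measurable_EFinP. Qed.

Lemma le_Rintegrable f g : measurable_fun setT f ->
  (forall x, `|f x| <= `|g x|) -> Rintegrable g -> Rintegrable f.
Proof.
move=> mf fg ig; apply: le_integrable ig => //; first exact/measurable_EFinP.
by move=> x _; rewrite lee_fin.
Qed.

Lemma bounded_Rintegrable f (M : R) : measurable_fun setT f ->
  (forall x, `|f x| <= M) -> Rintegrable f.
Proof.
move=> mf fM; apply: (@le_Rintegrable _ (cst M)) => //.
  by move=> x; rewrite (le_trans (fM x))// ler_norm.
exact: finite_measure_integrable_cst.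
Qed.

Lemma RintegrableD f g : Rintegrable f -> Rintegrable g -> Rintegrable (f \+ g).
Proof. exact: integrableD. Qed.

Lemma RintegrableB f g : Rintegrable f -> Rintegrable g -> Rintegrable (f \- g).
Proof. exact: integrableB. Qed.

Lemma RintegrableZ c f : Rintegrable f -> Rintegrable (fun x => c * f x).
Proof. exact: integrableZl. Qed.

Lemma Rintegrable_norm f : Rintegrable f -> Rintegrable (fun x => `|f x|).
Proof. exact: integrable_norm. Qed.

Lemma RintegrableM h f (M : R) : measurable_fun setT h ->
  (forall x, `|h x| <= M) -> Rintegrable f -> Rintegrable (fun x => h x * f x).
Proof.
move=> mh hM iF; apply: (@le_Rintegrable _ (fun x => M * f x)).
- by apply: measurable_funM => //; exact: Rintegrable_measurable.
- by move=> x; rewrite !normrM ler_wpM2r// (le_trans (hM x))// ler_norm.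
- exact: RintegrableZ.
Qed.

Lemma le_Rint f g : Rintegrable f -> Rintegrable g -> (forall x, f x <= g x) ->
  \int[mu]_x f x <= \int[mu]_x g x.
Proof. by move=> iF ig fg; apply: le_Rintegral. Qed.

Lemma Rint_norm_triangle f g h : Rintegrable f -> Rintegrable g ->
    Rintegrable h ->
  \int[mu]_x `|f x - h x| <=
  \int[mu]_x `|f x - g x| + \int[mu]_x `|g x - h x|.
Proof.
move=> iF ig ih.
have ifg : Rintegrable (fun x => `|f x - g x|).
  exact/Rintegrable_norm/RintegrableB.
have igh : Rintegrable (fun x => `|g x - h x|).
  exact/Rintegrable_norm/RintegrableB.
rewrite -RintegralD//; apply: le_Rint.
- exact/Rintegrable_norm/RintegrableB.
- exact: RintegrableD.
- by move=> x; exact: ler_distD.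
Qed.

Lemma EFin_Rint f : Rintegrable f ->
  ((\int[mu]_x f x)%:E = \int[mu]_x (f x)%:E)%E.
Proof. by move=> iF; rewrite /Rintegral fineK//; exact: integrable_fin_num. Qed.

Lemma EFin_Rint_in f B : measurable B -> Rintegrable f ->
  ((\int[mu]_x (\1_B x * f x)%R)%:E = \int[mu]_(x in B) (f x)%:E)%E.
Proof.
move=> mB iF; rewrite EFin_Rint; last first.
  apply: (@RintegrableM _ _ 1) => //.
  by move=> x; rewrite indicE; case: (_ \in _); rewrite ?normr1 ?normr0.
rewrite [RHS]integral_mkcond; apply: eq_integral => x _.
rewrite patchE indicE; by case: (x \in B); rewrite ?mul1r ?mul0r.
Qed.

End integrable_api.

(** * Existence of conditional expectations *)

Section sub_measure.
Context {d : measure_display} {T : measurableType d} {R : realType}.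
Variables (mu : {finite_measure set T -> \bar R}) (G : set (set T)).
Hypothesis sG : sigma_subalgebra G.

(** The restriction of [mu] to [G], as image measure under the identity. The proof of
    [sigma_subalgebra G] is an argument because the measure structure attached to [sub_measure sG]
    depends on it. *)
Definition sub_measure & sigma_subalgebra G :
    set (g_sigma_algebraType G) -> \bar R :=
  pushforward mu (id : T -> g_sigma_algebraType G).

Let sub_measure0 : sub_measure sG set0 = 0%E.
Proof. by rewrite /sub_measure /pushforward preimage_set0 measure0. Qed.

Let sub_measure_ge0 A : (0 <= sub_measure sG A)%E.
Proof. exact: (measure_ge0 mu). Qed.

Let sub_measure_sigma_additive : semi_sigma_additive (sub_measure sG).
Proof.
move=> F mF tF mUF; apply: (@measure_semi_sigma_additive _ _ _ mu) => //.
- move=> n; apply: (subalgebra_measurable sG).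
  by apply/(measurable_subalgebra _ sG); exact: mF.
- apply: (subalgebra_measurable sG).
  by apply/(measurable_subalgebra _ sG).
Qed.

HB.instance Definition _ := isMeasure.Build _ _ _ (sub_measure sG)
  sub_measure0 sub_measure_ge0 sub_measure_sigma_additive.

Let sub_measure_fin : fin_num_fun (sub_measure sG).
Proof.
move=> B mB; rewrite /sub_measure /pushforward fin_num_measure//.
by rewrite -[X in measurable X]setTI; exact: measurable_id_subalgebra.
Qed.

HB.instance Definition _ := Measure_isFinite.Build _ _ _ (sub_measure sG)
  sub_measure_fin.

End sub_measure.

Section sub_charge.
Context {d : measure_display} {T : measurableType d} {R : realType}.
Variables (mu : {finite_measure set T -> \bar R}) (G : set (set T)).
Variable f : T -> R.
Hypotheses (sG : sigma_subalgebra G) (iF : Rintegrable mu f).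

(** The charge on [G] whose density with respect to the restricted measure is the conditional
    expectation of [f]. *)
Definition sub_charge & sigma_subalgebra G & Rintegrable mu f :
    set (g_sigma_algebraType G) -> \bar R :=
  fun B => (\int[mu]_(x in (B : set T)) (f x)%:E)%E.

Let nu : {charge set T -> \bar R} := induced_charge iF.

Let sub_charge0 : sub_charge sG iF set0 = 0%E.
Proof. exact: (charge0 nu). Qed.

Let sub_charge_fin B : measurable B -> sub_charge sG iF B \is a fin_num.
Proof.
move=> mB; apply: (@fin_num_measure _ _ _ nu).
by apply: (subalgebra_measurable sG); apply/(measurable_subalgebra _ sG).
Qed.

Let sub_charge_sigma_additive : semi_sigma_additive (sub_charge sG iF).
Proof.
move=> F mF tF mUF; apply: (@charge_semi_sigma_additive _ _ _ nu) => //.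
- move=> n; apply: (subalgebra_measurable sG).
  by apply/(measurable_subalgebra _ sG); exact: mF.
- apply: (subalgebra_measurable sG).
  by apply/(measurable_subalgebra _ sG).
Qed.

HB.instance Definition _ := isCharge.Build _ _ _ (sub_charge sG iF)
  sub_charge0 sub_charge_fin sub_charge_sigma_additive.

Lemma sub_charge_dominates : sub_charge sG iF `<< sub_measure mu sG.
Proof.
apply/null_content_dominatesP => B mB muB0.
have mB' : measurable (B : set T).
  by apply: (subalgebra_measurable sG); apply/(measurable_subalgebra _ sG).
rewrite /sub_charge null_set_integral//.
exact: measurable_funTS (measurable_int mu iF).
Qed.

End sub_charge.

Section condexp_theory.
Context {d : measure_display} {T : measurableType d} {R : realType}.
Variable mu : {finite_measure set T -> \bar R}.
Implicit Types (G : set (set T)) (f g h : T -> R).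

Lemma normr_indic_le1 (B : set T) x : `|\1_B x : R| <= 1.
Proof. by rewrite indicE; case: (_ \in _); rewrite ?normr1 ?normr0. Qed.

(** Real integrals against indicators replace extended integrals over sets, so that linearity of the
    real integral applies directly. *)
Lemma is_condexpP G f g : sigma_subalgebra G -> Rintegrable mu f ->
  is_condexp mu G f g <->
  [/\ sub_measurable G g, Rintegrable mu g &
    forall B, G B -> \int[mu]_x (\1_B x * f x) = \int[mu]_x (\1_B x * g x)].
Proof.
move=> sG iF; split=> -[mg ig fg]; split=> // B GB;
  have mB := subalgebra_measurable sG GB.
  by apply: EFin_inj; rewrite !EFin_Rint_in//; exact: fg.
by rewrite -!EFin_Rint_in//; congr EFin; exact: fg.
Qed.

(** Radon-Nikodym on [G]; a change of variables along the identity turns integrals for the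
    restricted measure into integrals for [mu]. *)
Lemma condexp_exists G f : sigma_subalgebra G -> Rintegrable mu f ->
  exists g, is_condexp mu G f g.
Proof.
move=> sG iF.
have dom := @sub_charge_dominates _ _ _ mu _ _ sG iF.
pose S : measurableType _ := g_sigma_algebraType G.
pose nu : {charge set S -> \bar R} := sub_charge sG iF.
pose muG : {sigma_finite_measure set S -> \bar R} := sub_measure mu sG.
have {}dom : nu `<< muG := dom.
pose g := Radon_Nikodym nu muG.
(* The derivative is finite at every point, so [fine] loses nothing. *)
have gE : EFin \o (fine \o g) = g.
  by apply/funext => x /=; rewrite fineK// Radon_Nikodym_fin_num.
have mg : measurable_fun setT g.
  exact: (measurable_int _ (Radon_Nikodym_integrable dom)).
have mid := measurable_id_subalgebra sG.
have mgT : measurable_fun setT (g : T -> \bar R).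
  exact: (@measurable_comp _ _ _ _ _ _ setT g setT (id : T -> g_sigma_algebraType G)).
have ig : mu.-integrable setT (g : T -> \bar R).
  apply/integrableP; split => //.
  have /integrableP[_] := Radon_Nikodym_integrable dom.
  apply: le_lt_trans.
  rewrite [leRHS](ge0_integral_pushforward mid mu)//.
  exact: measurableT_comp.
exists (fine \o g); split.
- by apply/measurable_EFinP; rewrite gE.
- by rewrite gE.
- move=> B GB.
  have mB : @measurable _ (g_sigma_algebraType G) B.
    exact/(measurable_subalgebra _ sG).
  transitivity (nu B) => //; rewrite (Radon_Nikodym_integral dom mB).
  rewrite [LHS](integral_pushforward mid)//.
  apply: eq_integral => x _; by rewrite -[LHS]/(g x) -[in LHS]gE.
  apply: integrableS ig => //; exact: (subalgebra_measurable sG).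
Qed.

End condexp_theory.

(** * Linearity of the conditional expectation and the pull-out property *)

Section condexp_api.
Context {d : measure_display} {T : measurableType d} {R : realType}.
Variable mu : {finite_measure set T -> \bar R}.
Implicit Types (G : set (set T)) (f g h : T -> R).
Local Notation igr := (Rintegrable mu).

Lemma condexpP G f : sigma_subalgebra G -> igr f ->
  is_condexp mu G f (condexp mu G f).
Proof.
move=> sG iF; have [g gP] := condexp_exists sG iF.
exact: (@xgetPex _ (cst 0) [set g | is_condexp mu G f g] (ex_intro _ g gP)).
Qed.

Lemma is_condexp_Rintegrable G f g : is_condexp mu G f g -> igr g.
Proof. by case. Qed.

Lemma RintegrableM_indic B f : measurable B -> igr f ->
  igr (fun x => \1_B x * f x).
Proof.
move=> mB; apply: (@RintegrableM _ _ _ _ _ _ 1); first exact: measurable_indic.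
exact: normr_indic_le1.
Qed.

Lemma is_condexpD G f1 f2 g1 g2 : sigma_subalgebra G -> igr f1 -> igr f2 ->
  is_condexp mu G f1 g1 -> is_condexp mu G f2 g2 ->
  is_condexp mu G (f1 \+ f2) (g1 \+ g2).
Proof.
move=> sG i1 i2 /is_condexpP[]// m1 j1 e1 /is_condexpP[]// m2 j2 e2.
apply/is_condexpP => //; first exact: RintegrableD.
split; [exact: measurable_funD|exact: RintegrableD|] => B GB.
have mB := subalgebra_measurable sG GB.
under eq_Rintegral do rewrite mulrDr.
under [RHS]eq_Rintegral do rewrite mulrDr.
by rewrite !RintegralD ?e1 ?e2//; exact: RintegrableM_indic.
Qed.

Lemma is_condexpZ G c f g : sigma_subalgebra G -> igr f ->
  is_condexp mu G f g -> is_condexp mu G (fun x => c * f x) (fun x => c * g x).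
Proof.
move=> sG i1 /is_condexpP[]// m1 j1 e1.
apply/is_condexpP => //; first exact: RintegrableZ.
split; [exact: measurable_funM|exact: RintegrableZ|] => B GB.
have mB := subalgebra_measurable sG GB.
under eq_Rintegral do rewrite mulrCA.
under [RHS]eq_Rintegral do rewrite mulrCA.
by rewrite !RintegralZl ?e1//; exact: RintegrableM_indic.
Qed.

Lemma is_condexpB G f1 f2 g1 g2 : sigma_subalgebra G -> igr f1 -> igr f2 ->
  is_condexp mu G f1 g1 -> is_condexp mu G f2 g2 ->
  is_condexp mu G (f1 \- f2) (g1 \- g2).
Proof.
move=> sG i1 i2 c1 c2.
have subE (u v : T -> R) : u \- v = u \+ (fun x => -1 * v x).
  by apply/funext => x /=; rewrite mulN1r.
rewrite !subE; apply: is_condexpD => //; first exact: RintegrableZ.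
exact: is_condexpZ.
Qed.

Lemma is_condexp_id G f : sub_measurable G f -> igr f -> is_condexp mu G f f.
Proof. by []. Qed.

(* Subtracting [M * \1_(f >= 0) - M / 2] halves the sup norm. *)
Lemma bounded_sub_measurable_approx G (P : (T -> R) -> Prop) f (M e : R) :
  sigma_subalgebra G ->
  (forall c B, G B -> P (fun x => c * \1_B x)) ->
  (forall f1 f2, P f1 -> P f2 -> P (f1 \+ f2)) ->
  sub_measurable G f -> (forall x, `|f x| <= M) -> 0 < e ->
  exists2 g, P g & forall x, `|f x - g x| <= e.
Proof.
move=> sG Pind PD mf fM e0.
have GT : G setT by apply/(measurable_subalgebra _ sG).
suff H k : forall (M : R) (f : T -> R), sub_measurable G f -> (forall x, `|f x| <= M) ->
    exists2 g, P g & forall x, `|f x - g x| <= M / 2 ^+ k.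
  have [k Mk] : exists k : nat, M / 2 ^+ k <= e.
    have [k Mk] : exists k : nat, M / e <= k%:R.
      exists (Num.bound `|M / e|).
      by rewrite ltW// (le_lt_trans (ler_norm _))// archi_boundP.
    exists k; rewrite ler_pdivrMr ?exprn_gt0// mulrC -ler_pdivrMr//.
    rewrite (le_trans Mk)// -natrX ler_nat ltnW//.
    exact: ltn_expl.
  have [g Pg fg] := H k _ _ mf fM.
  by exists g => // x; rewrite (le_trans (fg x)).
elim: k => [|k IH] {M mf fM}M {}f mf fM.
  exists (fun x => 0 * \1_setT x); first exact: Pind.
  by move=> x; rewrite mul0r subr0 expr0 divr1.
have GB := sub_measurable_ge 0 sG mf.
pose s : T -> R := (fun x => M * \1_[set x | 0 <= f x] x) \+
  (fun x => - (M / 2) * \1_setT x).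
have Ps : P s by apply: PD; exact: Pind.
have [|x|g Pg fg] := IH (M / 2) (f \- s).
- apply: measurable_funB => //; apply: measurable_funD;
  by apply: measurable_funM => //; exact: sub_measurable_indic.
- have := fM x; rewrite /s/= indicT mulr1 indicE ler_norml => /andP[].
  have [f0|f0] := leP 0 (f x).
    by rewrite mem_set//= ler_norml => *; lra.
  rewrite memNset/=; last by apply/negP; rewrite -ltNge.
  by rewrite ler_norml => *; lra.
- exists (s \+ g); first exact: PD.
  move=> x; have := fg x; rewrite exprS invfM mulrA /=.
  by congr (`|_| <= _); rewrite /s/=; ring.
Qed.

Lemma le_norm_Rint f : igr f -> `|\int[mu]_x f x| <= \int[mu]_x `|f x|.
Proof. by move=> iF; exact: le_normr_Rintegral. Qed.

Lemma le_norm_RintM f h (M : R) : measurable_fun setT h ->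
  (forall x, `|h x| <= M) -> igr f ->
  `|\int[mu]_x (h x * f x)| <= M * \int[mu]_x `|f x|.
Proof.
move=> mh hM iF; rewrite (le_trans (le_norm_Rint _))//.
  exact: RintegrableM hM iF.
rewrite -RintegralZl//; last exact: Rintegrable_norm.
apply: le_Rint.
- by apply: Rintegrable_norm; exact: RintegrableM hM iF.
- by apply: RintegrableZ; exact: Rintegrable_norm.
- by move=> x; rewrite normrM ler_wpM2r.
Qed.

(** The identity holds by definition for indicators of sets of [G], hence for their combinations. A
    uniform approximation [k] of [h] transfers it, with an error of at most the sup norm of [h - k]
    times the sum [K] of the L^1 norms of [f] and [g]. *)
Lemma condexp_pull_out G f g h (M : R) : sigma_subalgebra G -> igr f ->
  is_condexp mu G f g -> sub_measurable G h -> (forall x, `|h x| <= M) ->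
  \int[mu]_x (h x * f x) = \int[mu]_x (h x * g x).
Proof.
move=> sG iF /is_condexpP[]// mg ig fg mh hM.
apply/eqP; rewrite -subr_eq0 -normr_le0; apply/ler_addgt0Pl => e e0.
rewrite addr0.
pose K := \int[mu]_x `|f x| + \int[mu]_x `|g x|.
have K0 : 0 <= K by rewrite addr_ge0// Rintegral_ge0.
have e'0 : 0 < e / (K + 1) by rewrite divr_gt0// ltr_wpDl.
(* Measurability and boundedness are carried along so that the products are integrable when two such
   functions are added. *)
pose P h := [/\ measurable_fun setT h, exists N, forall x, `|h x| <= N &
  \int[mu]_x (h x * f x) = \int[mu]_x (h x * g x)].
have [||k [mk [N kN] kE] hk] :=
  @bounded_sub_measurable_approx G P h M _ sG _ _ mh hM e'0.
- move=> c B GB; have mB := subalgebra_measurable sG GB; split.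
  + by apply: measurable_funM => //; exact: measurable_indic.
  + exists `|c| => x; rewrite normrM ler_piMr// ; exact: normr_indic_le1.
  + under eq_Rintegral do rewrite -mulrA.
    under [RHS]eq_Rintegral do rewrite -mulrA.
    by rewrite !RintegralZl ?fg//; exact: RintegrableM_indic.
- move=> h1 h2 [m1 [N1 b1] e1] [m2 [N2 b2] e2]; split.
  + exact: measurable_funD.
  + exists (N1 + N2) => x; by rewrite (le_trans (ler_normD _ _))// lerD.
  + under eq_Rintegral do rewrite mulrDl.
    under [RHS]eq_Rintegral do rewrite mulrDl.
    rewrite !RintegralD ?e1 ?e2//; by [exact: RintegrableM b1 _|exact: RintegrableM b2 _].
have mhT := sub_measurable_measurable sG mh.
have mhk : measurable_fun setT (h \- k) by exact: measurable_funB.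
have split_h u : igr u -> \int[mu]_x (h x * u x) =
    \int[mu]_x ((h \- k) x * u x) + \int[mu]_x (k x * u x).
  move=> iu; rewrite -(RintegralD measurableT); last 2 first.
  + exact: RintegrableM hk _.
  + exact: RintegrableM kN _.
  by apply: eq_Rintegral => x _ /=; rewrite -mulrDl subrK.
rewrite !split_h// kE opprD addrACA subrr addr0.
rewrite (le_trans (ler_normB _ _))//.
have := le_norm_RintM mhk hk iF; have := le_norm_RintM mhk hk ig.
move=> A B; rewrite (le_trans (lerD B A))// -mulrDr -/K.
by rewrite mulrAC ler_pdivrMr ?ltr_wpDl// ler_pM2l// lerDl.
Qed.

End condexp_api.

(** * The integrated Jensen inequality and its consequences *)

Section jensen.
Context {d : measure_display} {T : measurableType d} {R : realType}.
Variable mu : {finite_measure set T -> \bar R}.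
Implicit Types (G : set (set T)) (f g h : T -> R) (phi : R -> R).
Local Notation igr := (Rintegrable mu).

(** Convexity as the existence of a supporting line at every point, the form in which Jensen's
    inequality uses it. *)
Definition has_subgradients phi :=
  forall x, exists s, forall y, phi x + s * (y - x) <= phi y.

(** Add the supporting-line inequalities at [x] and at [y]. Monotonicity makes [s] Borel measurable
    and bounded on bounded intervals. *)
Lemma subgradient_nondecreasing phi (s : R -> R) :
  (forall x y, phi x + s x * (y - x) <= phi y) -> nondecreasing_fun s.
Proof.
move=> sP x y; rewrite le_eqVlt => /predU1P[->//|xy].
have := sP x y; have := sP y x => yx xy'.
have : 0 <= (s y - s x) * (y - x) by lra.
by rewrite pmulr_lge0 ?subr_gt0// subr_ge0.
Qed.

(** Integrate [phi (g x) + s (g x) * (f x - g x) <= phi (f x)]: the linear term vanishes by pull-out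
    once [s (g x)] is bounded. Hence the integral is first restricted to the sets [B N] of [G] where
    [g] is bounded by [N], and then [N] grows. *)
Lemma condexp_jensen G f g phi : sigma_subalgebra G -> igr f ->
  is_condexp mu G f g -> measurable_fun setT phi -> (forall x, 0 <= phi x) ->
  has_subgradients phi ->
  (\int[mu]_x (phi (g x))%:E <= \int[mu]_x (phi (f x))%:E)%E.
Proof.
move=> sG iF fg mphi phi0 /choice[s sP].
have [mg ig _] := fg.
have mgT := sub_measurable_measurable sG mg.
have mf := Rintegrable_measurable iF.
have mphig : measurable_fun setT (phi \o g) by exact: measurableT_comp.
have mphif : measurable_fun setT (phi \o f) by exact: measurableT_comp.
have [->|] := eqVneq (\int[mu]_x (phi (f x))%:E)%E +oo%E; first by rewrite leey.
rewrite -ltey => phifoo.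
have iphif : igr (phi \o f).
  apply/integrableP; split; first exact/measurable_EFinP.
  by under eq_integral do rewrite /= ger0_norm//.
have s_nd := subgradient_nondecreasing sP.
pose B (N : nat) := [set x | `|g x| <= N%:R].
have GB N : G (B N).
  apply/(measurable_subalgebra _ sG).
  rewrite (_ : B N = setT `&` g @^-1` `[- N%:R, N%:R]); last first.
    by rewrite setTI; apply/seteqP; split=> x; rewrite /B/= in_itv/= ler_norml.
  by apply: (mg measurableT); exact: measurable_itv.
have mB N := subalgebra_measurable sG (GB N).
have BN N : (\int[mu]_(x in B N) (phi (g x))%:E <=
             \int[mu]_x (phi (f x))%:E)%E.
  pose h x := \1_(B N) x * s (g x).
  have mh : sub_measurable G h.
    apply: measurable_funM; first exact: sub_measurable_indic.
    apply: (measurableT_comp (f := s)) => //.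
    exact: nondecreasing_measurable.
  have mhT := sub_measurable_measurable sG mh.
  (* On [B N] the monotone [s] takes values between those at [- N] and [N]. *)
  have hM x : `|h x| <= `|s N%:R| + `|s (- N%:R)|.
    rewrite /h indicE; have [|_] := boolP (x \in _); last first.
      by rewrite mul0r normr0 addr_ge0.
    rewrite inE /B/= ler_norml mul1r => /andP[/s_nd h1 /s_nd h2].
    rewrite ler_norml; apply/andP; split.
      rewrite (le_trans _ h1)//.
      have := ler_norm (- s (- N%:R)); rewrite normrN.
      have := normr_ge0 (s N%:R); lra.
    by rewrite (le_trans h2)// (le_trans (ler_norm _))// lerDl.
  have ihf : igr (fun x => h x * f x) by exact: RintegrableM hM _.
  have ihg : igr (fun x => h x * g x) by exact: RintegrableM hM _.
  have iv : igr (fun x => phi (f x) - (h x * f x - h x * g x)).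
    apply: RintegrableB => //; exact: RintegrableB.
  have uv x : \1_(B N) x * phi (g x) <= phi (f x) - (h x * f x - h x * g x).
    rewrite /h indicE; case: (x \in B N); last by rewrite !mul0r !subr0.
    by rewrite !mul1r; have := sP (g x) (f x); lra.
  have u0 x : 0 <= \1_(B N) x * phi (g x).
    by rewrite mulr_ge0// indicE; case: (_ \in _).
  apply: (@le_trans _ _ (\int[mu]_x (\1_(B N) x * phi (g x))%:E)%E).
    rewrite integral_mkcond le_eqVlt; apply/orP; left; apply/eqP.
    apply: eq_integral => x _; rewrite patchE indicE.
    by case: (x \in _); rewrite ?mul1r ?mul0r.
  apply: (@le_trans _ _
    (\int[mu]_x (phi (f x) - (h x * f x - h x * g x))%:E)%E).
    apply: ge0_le_integral => //.
    - by move=> x _; rewrite lee_fin.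
    - by apply/measurable_EFinP; exact: measurable_funM.
    - by apply/measurable_EFinP; exact: Rintegrable_measurable iv.
    - by move=> x _; rewrite lee_fin.
  rewrite -!EFin_Rint// lee_fin RintegralB ?RintegralB//.
    by rewrite (condexp_pull_out sG iF fg mh hM) subrr subr0.
  exact: RintegrableB.
(* The sets [B N] increase to the whole space, so monotone convergence removes the restriction. *)
have UB : \bigcup_N B N = setT.
  apply/seteqP; split=> // x _; exists (Num.bound `|g x|) => //=.
  by rewrite /B/= ltW// archi_boundP.
have ndB : nondecreasing_seq B.
  move=> m n mn; apply/subsetPset => x /=; rewrite /B/= => /le_trans; apply.
  by rewrite ler_nat.
have := @ge0_nondecreasing_set_cvg_integral _ _ _ B (EFin \o (phi \o g)) mu ndB mB.
rewrite UB => cvgB.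
have {}cvgB := cvgB (fun i => measurable_funTS (proj2 (measurable_EFinP _ _) mphig))
  (fun i x _ => phi0 (g x)).
rewrite -(cvg_lim _ cvgB)//; apply: lime_le; first by apply/cvg_ex; eexists; exact: cvgB.
by apply: nearW => N; exact: BN.
Qed.

Lemma has_subgradients_norm : has_subgradients (fun x : R => `|x|).
Proof.
move=> x; exists (Num.sg x) => y.
rewrite mulrBr -normrEsg addrC subrK.
rewrite (le_trans (ler_norm _))// normrM normr_sg.
by case: (x != 0); rewrite ?mul1r ?mul0r.
Qed.

(** The supporting line is flat where [|x| <= M] and is that of the absolute value elsewhere. *)
Lemma has_subgradients_excess (M : R) : 0 <= M ->
  has_subgradients (fun x : R => Num.max 0 (`|x| - M)).
Proof.
move=> M0 x; have [xM|xM] := leP `|x| M.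
  exists 0 => y; rewrite mul0r addr0.
  by rewrite [leLHS]max_l ?le_max ?lexx// subr_le0.
have [s sP] := has_subgradients_norm x.
exists s => y; rewrite [X in X + _]max_r; last by rewrite subr_ge0 ltW.
by rewrite le_max; apply/orP; right; have := sP y; lra.
Qed.

Lemma condexp_norm_le G f g : sigma_subalgebra G -> igr f ->
  is_condexp mu G f g -> \int[mu]_x `|g x| <= \int[mu]_x `|f x|.
Proof.
move=> sG iF fg; have ig := is_condexp_Rintegrable fg.
rewrite -lee_fin !EFin_Rint; try exact: Rintegrable_norm.
apply: (condexp_jensen sG iF fg) => //.
exact: has_subgradients_norm.
Qed.

Lemma condexp_contraction G f1 f2 g1 g2 : sigma_subalgebra G ->
  igr f1 -> igr f2 -> is_condexp mu G f1 g1 -> is_condexp mu G f2 g2 ->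
  \int[mu]_x `|g1 x - g2 x| <= \int[mu]_x `|f1 x - f2 x|.
Proof.
move=> sG i1 i2 c1 c2.
exact: condexp_norm_le sG (RintegrableB i1 i2) (is_condexpB sG i1 i2 c1 c2).
Qed.

(** Jensen for the excess [max 0 (|x| - M)], which vanishes exactly on [[-M, M]]: its integral is
    zero for [f], hence for [g]. *)
Lemma condexp_bounded G f g (M : R) : sigma_subalgebra G -> igr f ->
  is_condexp mu G f g -> 0 <= M -> {ae mu, forall x, `|f x| <= M} ->
  {ae mu, forall x, `|g x| <= M}.
Proof.
move=> sG iF fg M0 fM.
pose phi (x : R) := Num.max 0 (`|x| - M).
have mphi : measurable_fun setT phi.
  apply: measurable_maxr => //; apply: measurable_funB => //.
have phi0 x : 0 <= phi x by rewrite le_max lexx.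
have mf := Rintegrable_measurable iF.
have mg := Rintegrable_measurable (is_condexp_Rintegrable fg).
have := condexp_jensen sG iF fg mphi phi0 (has_subgradients_excess M0).
have -> : (\int[mu]_x (phi (f x))%:E = 0)%E.
  rewrite (ae_eq_integral (cst 0%E))//; first exact: integral0.
    by apply/measurable_EFinP; exact: measurableT_comp.
  apply: filterS fM => x fxM _ /=; congr EFin.
  by rewrite /phi max_l// subr_le0.
move=> phig0.
have : (\int[mu]_x `|(EFin \o (phi \o g)) x| = 0)%E.
  apply/eqP; rewrite eq_le integral_ge0// andbT (le_trans _ phig0)//.
  by under eq_integral do rewrite /= ger0_norm//.
move/ae_eq_integral_abs => /(_ measurableT) H.
have /H : measurable_fun setT (EFin \o (phi \o g)).
  by apply/measurable_EFinP; exact: measurableT_comp.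
apply: filterS => x /(_ Logic.I) /= [].
rewrite /phi => /eqP; rewrite eq_maxl.
by rewrite subr_le0.
Qed.

End jensen.

(** * Epsilon criteria for convergence to zero in the extended reals *)

Section ereal_cvg0.
Context {R : realType}.

Lemma ge0_cvge0P (u : nat -> \bar R) : (forall n, 0 <= u n)%E ->
  u @ \oo --> 0%E <->
  forall e : R, 0 < e -> \forall n \near \oo, (u n <= e%:E)%E.
Proof.
move=> u0; split=> [/fine_cvgP[ufin /cvgr0_norm_le ucvg] e e0|H].
  near=> n.
  have ufn : u n \is a fin_num by near: n.
  rewrite -(fineK ufn) lee_fin (le_trans (ler_norm _))//.
  by near: n; exact: ucvg.
apply/fine_cvgP; split.
  near=> n; rewrite ge0_fin_numE//.
  by apply: (@le_lt_trans _ _ 1%:E); [near: n; exact: H|rewrite ltry].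
apply/cvgrPdist_le => /= e e0; near=> n.
rewrite sub0r normrN ger0_norm ?fine_ge0//.
have une : (u n <= e%:E)%E by near: n; exact: H.
by rewrite -lee_fin fineK// ge0_fin_numE// (le_lt_trans une)// ltry.
Unshelve. all: by end_near. Qed.

Lemma abs_cvge0P (u : nat -> R) :
  (u n)%:E @[n --> \oo] --> 0%E <->
  forall e : R, 0 < e -> \forall n \near \oo, `|u n| <= e.
Proof.
split=> [/fine_cvgP[_ /cvgr0_norm_le]//|H].
apply/fine_cvgP; split; first by near=> n.
apply/cvgrPdist_le => /= e e0; near=> n.
by rewrite sub0r normrN; near: n; exact: H.
Unshelve. all: by end_near. Qed.

End ereal_cvg0.

(** * Truncation, bounded versions and self-adjointness *)

Section condexp_versions.
Context {d : measure_display} {T : measurableType d} {R : realType}.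
Variable mu : {finite_measure set T -> \bar R}.
Implicit Types (G D : set (set T)) (f g h : T -> R).
Local Notation igr := (Rintegrable mu).

Lemma ae_eq_Rint f g : measurable_fun setT f -> measurable_fun setT g ->
  {ae mu, forall x, f x = g x} -> \int[mu]_x f x = \int[mu]_x g x.
Proof.
move=> mf mg fg; congr fine; apply: ae_eq_integral => //.
- exact/measurable_EFinP.
- exact/measurable_EFinP.
- by apply: filterS fg => x -> _.
Qed.

Definition clip (M : R) (x : R) := Num.max (- M) (Num.min x M).

Lemma clip_id (M x : R) : `|x| <= M -> clip M x = x.
Proof.
by rewrite ler_norml => /andP[Mx xM]; rewrite /clip min_l// max_r.
Qed.

Lemma clip_bound (M x : R) : 0 <= M -> `|clip M x| <= M.
Proof.
move=> M0; rewrite ler_norml /clip le_max lexx/= ge_max ge_min lexx orbT andbT.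
by rewrite (le_trans _ M0)// oppr_le0.
Qed.

Lemma clip_contract (M x : R) : 0 <= M -> `|x - clip M x| <= `|x|.
Proof.
move=> M0; have [xM|Mx] := leP `|x| M.
  by rewrite clip_id// subrr normr0.
rewrite /clip; have [x0|x0] := leP 0 x.
  move: Mx; rewrite ger0_norm// => Mx.
  rewrite min_r; last exact: ltW.
  rewrite max_r; last by rewrite (le_trans _ M0)// oppr_le0.
  by rewrite !ger0_norm; lra.
move: Mx; rewrite ltr0_norm// => Mx.
rewrite min_l; last by lra.
rewrite max_l; last by lra.
by rewrite !ler0_norm; lra.
Qed.

Lemma measurable_clip M : measurable_fun setT (clip M).
Proof. by apply: measurable_maxr => //; exact: measurable_minr. Qed.

(** A version is bounded only almost everywhere; clipping it at [M] gives a bound at every point and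
    changes it on a null set only, while keeping it [G]-measurable. *)
Lemma condexp_bounded_version G f g (M : R) : sigma_subalgebra G -> igr f ->
  is_condexp mu G f g -> 0 <= M -> {ae mu, forall x, `|f x| <= M} ->
  exists g', [/\ is_condexp mu G f g', forall x, `|g' x| <= M &
    {ae mu, forall x, g x = g' x}].
Proof.
move=> sG iF fg M0 fM.
have gM := condexp_bounded sG iF fg M0 fM.
have gg' : {ae mu, forall x, g x = clip M (g x)}.
  by apply: filterS gM => x gxM; rewrite clip_id.
have [mg ig Eg] := (is_condexpP g sG iF).1 fg.
have mg' : sub_measurable G (clip M \o g).
  by apply: (measurableT_comp (f := clip M)) => //; exact: measurable_clip.
have g'M x : `|(clip M \o g) x| <= M by exact: clip_bound.
have mgT := sub_measurable_measurable sG mg.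
have mg'T := sub_measurable_measurable sG mg'.
exists (clip M \o g); split=> //.
apply/is_condexpP => //; split=> //; first exact: bounded_Rintegrable mg'T g'M.
move=> B GB; rewrite Eg//.
have mB := subalgebra_measurable sG GB.
apply: ae_eq_Rint; [exact: measurable_funM|exact: measurable_funM|].
by apply: filterS gg' => x /= <-.
Qed.

(** Replacing the chosen version of the conditional expectation of [\1_A] by one with values in
    [[-1, 1]] makes the pairing with any integrable [g] an integrable product. The last clause is
    self-adjointness of the projection off [D]. *)
Lemma condexp_perp_version D (A : set T) : sigma_subalgebra D -> measurable A ->
  exists p : T -> R, [/\ measurable_fun setT p, forall x, `|p x| <= 2,
    forall g, igr g ->
      (\int[mu]_x (condexp_perp mu D \1_A x * g x)%:E)%E =
      (\int[mu]_x (p x * g x))%:E &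
    forall g gD (M : R), igr g -> 0 <= M -> {ae mu, forall x, `|g x| <= M} ->
      is_condexp mu D g gD ->
      \int[mu]_x (p x * g x) = \int[mu]_x (\1_A x * (g x - gD x))].
Proof.
move=> sD mA.
have m1 : measurable_fun setT (\1_A : T -> R) by exact: measurable_indic.
have i1 : igr \1_A by exact: bounded_Rintegrable m1 (normr_indic_le1 A).
have cP := condexpP sD i1.
have mc := sub_measurable_measurable sD (let: And3 h _ _ := cP in h).
have [|c' [c'P c'1 cc']] := condexp_bounded_version sD i1 cP ler01.
  by apply: aeW => x; exact: normr_indic_le1.
have [mc' ic' _] := c'P.
have mc'T := sub_measurable_measurable sD mc'.
exists (fun x => \1_A x - c' x); split.
- exact: measurable_funB.
- move=> x; rewrite (le_trans (ler_normB _ _))// -[leRHS]/(1 + 1).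
  by rewrite lerD// normr_indic_le1.
- move=> g ig; have mg := Rintegrable_measurable ig.
  rewrite EFin_Rint; last first.
    apply: (@RintegrableM _ _ _ _ _ _ 2) => //; first exact: measurable_funB.
    move=> x; rewrite (le_trans (ler_normB _ _))// -[leRHS]/(1 + 1).
    by rewrite lerD// normr_indic_le1.
  apply: ae_eq_integral => //.
  + apply/measurable_EFinP; apply: measurable_funM => //.
    exact: measurable_funB.
  + apply/measurable_EFinP; apply: measurable_funM => //.
    exact: measurable_funB.
  + by apply: filterS cc' => x <-.
- move=> g gD M ig M0 gM gDP.
  have [g' [g'P g'M gg']] := condexp_bounded_version sD ig gDP M0 gM.
  have [mgD igD _] := gDP.
  have [mg' ig' _] := g'P.
  have mgDT := sub_measurable_measurable sD mgD.
  have mg'T := sub_measurable_measurable sD mg'.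
  have i1g : igr (fun x => \1_A x * g x) by exact: RintegrableM_indic.
  have i1gD : igr (fun x => \1_A x * gD x) by exact: RintegrableM_indic.
  under eq_Rintegral do rewrite mulrBl.
  under [RHS]eq_Rintegral do rewrite mulrBr.
  rewrite !RintegralB//; last by exact: RintegrableM c'1 _.
  congr (_ - _).
  (* Both sides equal the integral of [c' * g']: pull out [c'] against [g], then [g'] against
     [\1_A]. *)
  rewrite (condexp_pull_out sD ig g'P mc' c'1).
  under eq_Rintegral do rewrite mulrC.
  rewrite -(condexp_pull_out sD i1 c'P mg' g'M).
  apply: ae_eq_Rint; [exact: measurable_funM|exact: measurable_funM|].
  by apply: filterS gg' => x ->; rewrite mulrC.
Qed.

Lemma Rint_indic_dist (A B : set T) : measurable A -> measurable B ->
  (\int[mu]_x `|\1_A x - \1_B x : R|)%:E = mu (A `+` B).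
Proof.
move=> mA mB.
have mAB : measurable (A `+` B) by apply: measurableU; exact: measurableD.
have E (x : T) : `|\1_A x - \1_B x : R| = \1_(A `+` B) x.
  rewrite !indicE in_setU !in_setD.
  by case: (x \in A); case: (x \in B);
    rewrite /= ?subrr ?subr0 ?sub0r ?normrN ?normr0 ?normr1.
under eq_Rintegral do rewrite E.
rewrite EFin_Rint; first by rewrite integral_indic// setIT.
apply: (@bounded_Rintegrable _ _ _ _ _ 1); first exact: measurable_indic.
exact: normr_indic_le1.
Qed.

End condexp_versions.

Lemma Rint_distC (d : measure_display) (T : measurableType d) (R : realType)
    (mu : {measure set T -> \bar R}) (f g : T -> R) :
  \int[mu]_x `|f x - g x| = \int[mu]_x `|g x - f x|.
Proof. by apply: eq_Rintegral => x _; rewrite distrC. Qed.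

Lemma condexp_unique (d : measure_display) (T : measurableType d) (R : realType)
    (mu : {finite_measure set T -> \bar R}) (G : set (set T)) (f g1 g2 : T -> R) :
  sigma_subalgebra G -> Rintegrable mu f -> is_condexp mu G f g1 ->
  is_condexp mu G f g2 -> \int[mu]_x `|g1 x - g2 x| <= 0.
Proof.
move=> sG iF g1P g2P; rewrite (le_trans (condexp_contraction sG iF iF g1P g2P))//.
under eq_Rintegral do rewrite subrr normr0.
by rewrite Rintegral_cst// mul0r.
Qed.

(** * L^1 convergence of conditional expectations of bounded functions *)

Section L1_convergence.
Context {d : measure_display} {T : measurableType d} {R : realType}.
Variable mu : {finite_measure set T -> \bar R}.
Variables (An : nat -> set (set T)) (D : set (set T)).
Hypothesis sA : forall n, sigma_subalgebra (An n).
Hypothesis sD : sigma_subalgebra D.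
Implicit Types (f g h : T -> R).
Local Notation igr := (Rintegrable mu).

(** Some version is asked for instead of the chosen one: a sum of versions is a version of the sum,
    but a sum of chosen versions need not be the chosen one. *)
Let versions_converge h := forall e : R, 0 < e -> \forall n \near \oo,
  exists2 v, is_condexp mu (An n) h v & \int[mu]_x `|v x - h x| <= e.

(** Since [\1_(A n)] is its own conditional expectation, contraction and the triangle inequality
    bound the distance from the conditional expectation of [\1_B] to [\1_B] by twice the measure of
    the symmetric difference of [A n] and [B]. *)
Lemma versions_converge_indic c (B : set T) : mu_convergence mu An D -> D B ->
  versions_converge (fun x => c * \1_B x).
Proof.
move=> muc DB e e0; have [A AnA AB] := muc B DB.
have mB := subalgebra_measurable sD DB.
have mA n := subalgebra_measurable (sA n) (AnA n).
have i1 (C : set T) : measurable C -> igr \1_C.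
  move=> mC; apply: (@bounded_Rintegrable _ _ _ _ _ 1).
    exact: measurable_indic.
  exact: normr_indic_le1.
(* The 2 pays for the two uses of the symmetric difference, the other factor for [c]; adding 1 keeps
   it nonzero. *)
have e'0 : 0 < e / 2 / (`|c| + 1) by rewrite !divr_gt0// ltr_wpDl.
move/ge0_cvge0P : AB => /(_ (fun=> measure_ge0 _ _))/(_ _ e'0).
apply: filterS => n /=.
rewrite -(Rint_indic_dist mu (mA n) mB) lee_fin => ABn.
have vP := condexpP (sA n) (i1 _ mB).
exists (fun x => c * condexp mu (An n) \1_B x).
  by apply: is_condexpZ => //; exact: i1.
have iv := is_condexp_Rintegrable vP.
under eq_Rintegral do rewrite -mulrBr normrM.
rewrite RintegralZl//; last exact/Rintegrable_norm/RintegrableB/i1.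
have i1A := i1 _ (mA n); have i1B := i1 _ mB.
have := Rint_norm_triangle iv i1A i1B.
have c1A : is_condexp mu (An n) \1_(A n) \1_(A n).
  by apply: is_condexp_id => //; exact: sub_measurable_indic.
have := condexp_contraction (sA n) i1B i1A vP c1A.
rewrite (Rint_distC _ \1_B) => h1 h2.
have {h1 h2} h3 : \int[mu]_x `|condexp mu (An n) \1_B x - \1_B x| <=
    e / (`|c| + 1).
  rewrite (le_trans h2)// (le_trans (lerD h1 (lexx _)))//.
  rewrite (le_trans (lerD ABn ABn))// -mulrDl -splitr//.
rewrite (le_trans (ler_wpM2l (normr_ge0 c) h3))// mulrCA ler_piMr ?ltW//.
by rewrite ltr_pdivrMr ?ltr_wpDl// mul1r ltrDl.
Qed.

Lemma versions_convergeD f g : igr f -> igr g ->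
  versions_converge f -> versions_converge g -> versions_converge (f \+ g).
Proof.
move=> iF ig cf cg e e0.
have e20 : 0 < e / 2 by rewrite divr_gt0.
have := cf _ e20; have := cg _ e20; apply: filterS2 => n [v vP vg] [u uP uf].
exists (u \+ v); first exact: is_condexpD.
have iu := is_condexp_Rintegrable uP; have iv := is_condexp_Rintegrable vP.
have i1 : igr (fun x => `|u x - f x|) by exact/Rintegrable_norm/RintegrableB.
have i2 : igr (fun x => `|v x - g x|) by exact/Rintegrable_norm/RintegrableB.
rewrite (splitr e) (le_trans _ (lerD uf vg))// -RintegralD//; apply: le_Rint.
- by apply/Rintegrable_norm/RintegrableB; exact: RintegrableD.
- exact: RintegrableD.
- by move=> x /=; rewrite opprD addrACA ler_normD.
Qed.

Lemma versions_converge_bounded h (M : R) : mu_convergence mu An D ->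
  sub_measurable D h -> (forall x, `|h x| <= M) -> versions_converge h.
Proof.
move=> muc mh hM e e0.
pose K := fine (mu setT).
have K0 : 0 <= K by rewrite fine_ge0.
(* Replacing [h] by [k] costs [K * e'] twice, before and after conditioning; the convergence for [k]
   costs [e']. *)
pose e' := e / (2 * K + 1).
have e'0 : 0 < e' by rewrite divr_gt0// ltr_wpDl// mulr_ge0.
have Ke : 2 * K * e' + e' = e.
  by rewrite -{2}(mul1r e') -mulrDl mulrC divfK// gt_eqF// ltr_wpDl// mulr_ge0.
pose P k := igr k /\ versions_converge k.
have ih : igr h.
  exact: bounded_Rintegrable (sub_measurable_measurable sD mh) hM.
have [|f1 f2 [i1 c1] [i2 c2]|k [ik ck] hk] :=
    @bounded_sub_measurable_approx _ _ _ D P h M _ sD _ _ mh hM e'0.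
- move=> c B DB; split; last exact: versions_converge_indic.
  apply/RintegrableZ/(@bounded_Rintegrable _ _ _ _ _ 1).
    exact: measurable_indic (subalgebra_measurable sD DB).
  exact: normr_indic_le1.
- by split; [exact: RintegrableD|exact: versions_convergeD].
have hk1 : \int[mu]_x `|h x - k x| <= K * e'.
  rewrite mulrC -(Rintegral_cst mu measurableT).
  apply: le_Rint => //; first exact/Rintegrable_norm/RintegrableB.
  exact: finite_measure_integrable_cst.
have := ck _ e'0; apply: filterS => n [v vP vk].
have uP := condexpP (sA n) ih.
exists (condexp mu (An n) h) => //.
have iu := is_condexp_Rintegrable uP; have iv := is_condexp_Rintegrable vP.
have := Rint_norm_triangle iu iv ih.
have := Rint_norm_triangle iv ik ih.
have := condexp_contraction (sA n) ih ik uP vP.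
rewrite (Rint_distC _ k).
move: hk1 Ke vk => /=; lra.
Qed.

(** Orthogonal convergence tested against bounded functions, a form that does not mention the Young
    function. *)
Hypothesis perp : forall A : nat -> set T, (forall n, An n (A n)) ->
  forall g (M : R), measurable_fun setT g -> (forall x, `|g x| <= M) ->
    (\int[mu]_x (condexp_perp mu D \1_(A n) x * g x)%:E)%E
      @[n --> \oo] --> 0%E.

Lemma positive_part_perp_cvg0 f (M : R) (w : nat -> T -> R) :
  measurable_fun setT f -> (forall x, `|f x| <= M) ->
  is_condexp mu D f (cst 0) -> (forall n, is_condexp mu (An n) f (w n)) ->
  forall e, 0 < e -> \forall n \near \oo,
    \int[mu]_x (\1_[set x | 0 <= w n x] x * w n x) <= e.
Proof.
move=> mf fM f0 wP e e0.
have iF : igr f by exact: bounded_Rintegrable fM.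
pose A n := [set x | 0 <= w n x].
have AnA n : An n (A n).
  by apply: sub_measurable_ge (sA n) _; have [] := wP n.
have mA n := subalgebra_measurable (sA n) (AnA n).
(* Self-adjointness moves the projection onto [f], whose conditional expectation on [D] is zero; as
   [A n] is in [An n], [f] may then be replaced by [w n]. *)
have PA n : (\int[mu]_x (condexp_perp mu D \1_(A n) x * f x)%:E)%E =
    (\int[mu]_x (\1_(A n) x * w n x))%:E.
  have [p [mp p2 pE pB]] := condexp_perp_version mu sD (mA n).
  have [_ _ wE] := (is_condexpP _ (sA n) iF).1 (wP n). rewrite -wE//.
  rewrite pE// (pB _ _ `|M| iF _ _ f0)//.
  - by congr EFin; apply: eq_Rintegral => x _; rewrite subr0.
  - by apply: aeW => x; rewrite (le_trans (fM x))// ler_norm.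
have := perp AnA mf fM; under eq_fun do rewrite PA.
move=> /abs_cvge0P/(_ _ e0); apply: filterS => n.
by apply: le_trans; exact: ler_norm.
Qed.

(** The positive-part estimate for [f] and for [- f] controls both parts of [w n]. *)
Lemma perp_condexp_cvg0 f (M : R) (w : nat -> T -> R) :
  measurable_fun setT f -> (forall x, `|f x| <= M) ->
  is_condexp mu D f (cst 0) -> (forall n, is_condexp mu (An n) f (w n)) ->
  forall e, 0 < e -> \forall n \near \oo, \int[mu]_x `|w n x| <= e.
Proof.
move=> mf fM f0 wP e e0.
have iF : igr f by exact: bounded_Rintegrable fM.
have e20 : 0 < e / 2 by rewrite divr_gt0.
have mNf : measurable_fun setT (fun x => -1 * f x) by exact: measurable_funM.
have NfM x : `|-1 * f x| <= M by rewrite mulN1r normrN.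
have Nf0 : is_condexp mu D (fun x => -1 * f x) (cst 0).
  have := is_condexpZ (-1) sD iF f0.
  by congr is_condexp; apply/funext => x; rewrite mulr0.
have NwP n : is_condexp mu (An n) (fun x => -1 * f x) (fun x => -1 * w n x).
  exact: is_condexpZ.
have := positive_part_perp_cvg0 mNf NfM Nf0 NwP e20.
have := positive_part_perp_cvg0 mf fM f0 wP e20.
apply: filterS2 => n h1 h2.
have [mw iw _] := wP n; have [mNw iNw _] := NwP n.
have i1 : igr (fun x => \1_[set x | 0 <= w n x] x * w n x).
  apply: RintegrableM_indic => //.
  exact: subalgebra_measurable (sA n) (sub_measurable_ge 0 (sA n) mw).
have i2 : igr (fun x => \1_[set x | 0 <= -1 * w n x] x * (-1 * w n x)).
  apply: RintegrableM_indic => //.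
  exact: subalgebra_measurable (sA n) (sub_measurable_ge 0 (sA n) mNw).
rewrite (splitr e) (le_trans _ (lerD h1 h2))// -RintegralD//; apply: le_Rint.
- exact: Rintegrable_norm.
- exact: RintegrableD.
- move=> x; rewrite !indicE; have [x0|x0] := leP 0 (w n x).
    rewrite mem_set// mul1r ger0_norm// lerDl.
    have [|_] := boolP (x \in [set x | 0 <= -1 * w n x]); last by rewrite mul0r.
    by rewrite inE/= mul1r.
  rewrite memNset/=; last by apply/negP; rewrite -ltNge.
  rewrite mem_set/=; last by rewrite mulN1r oppr_ge0 ltW.
  by rewrite mul0r add0r mul1r mulN1r ltr0_norm.
Qed.

Lemma condexp_bounded_cvg f (M : R) : mu_convergence mu An D ->
  measurable_fun setT f -> (forall x, `|f x| <= M) ->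
  forall e, 0 < e -> \forall n \near \oo,
    \int[mu]_x `|condexp mu (An n) f x - condexp mu D f x| <= e.
Proof.
move=> muc mf fM e e0.
have fM' x : `|f x| <= `|M| by rewrite (le_trans (fM x))// ler_norm.
have iF : igr f by exact: bounded_Rintegrable fM.
have uP := condexpP sD iF.
(* A version bounded everywhere, so that both [u'] and [f - u'] are bounded functions. *)
have [u' [u'P u'M _]] := condexp_bounded_version sD iF uP (normr_ge0 M)
  (aeW mu fM').
have [mu' iu' _] := u'P; have [mu_ iu _] := uP.
have mu'T := sub_measurable_measurable sD mu'.
have e20 : 0 < e / 2 by rewrite divr_gt0.
have mf0 : measurable_fun setT (f \- u') by exact: measurable_funB.
have f0M x : `|(f \- u') x| <= `|M| + `|M|.
  by rewrite (le_trans (ler_normB _ _))// lerD.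
have f0P : is_condexp mu D (f \- u') (cst 0).
  have := is_condexpB sD iF iu' u'P (is_condexp_id mu' iu').
  by congr is_condexp; apply/funext => x; rewrite /= subrr.
have cP n := condexpP (sA n) iF.
have vP n := condexpP (sA n) iu'.
have wP n := is_condexpB (sA n) iF iu' (cP n) (vP n).
have := perp_condexp_cvg0 mf0 f0M f0P wP e20.
have := versions_converge_bounded muc mu' u'M e20.
apply: filterS2 => n [v v'P vu] w0.
have iv := is_condexp_Rintegrable (vP n).
have iv' := is_condexp_Rintegrable v'P.
have ic := is_condexp_Rintegrable (cP n).
have vv := condexp_unique (sA n) iu' (vP n) v'P.
have uu := condexp_unique sD iF u'P uP.
(* The chain runs from [condexp mu (An n) f] through [condexp mu (An n) u'], [v] and [u'] to
   [condexp mu D f], with steps of at most [e / 2], 0, [e / 2] and 0. *)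
have := Rint_norm_triangle ic iv iu.
have := Rint_norm_triangle iv iv' iu.
have := Rint_norm_triangle iv' iu' iu.
move: w0 => /=; lra.
Qed.

End L1_convergence.

(** * Young functions and their complementary functions *)

Section young_theory.
Context {R : realType}.
Variable phi : R -> R.
Hypothesis yphi : young_function phi.

Lemma young_convexE (t x y : R) : 0 <= t -> t <= 1 ->
  phi (t * x + (1 - t) * y) <= t * phi x + (1 - t) * phi y.
Proof.
move=> t0 t1.
have tP : Itv.spec (@Itv.num_sem R) (Itv.Real `[0%Z, 1%Z]) t.
  by rewrite /Itv.spec/= /Itv.num_sem/= in_itv/= t0 t1 andbT ger0_real.
exact: (young_convex yphi (Itv.mk tP) (mem_set I) (mem_set I)).
Qed.

Lemma young_three_points (x y z : R) : y < x -> x < z ->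
  phi x * (z - y) <= (z - x) * phi y + (x - y) * phi z.
Proof.
move=> yx xz; have zy : 0 < z - y by rewrite subr_gt0 (lt_trans yx).
have t0 : 0 <= (z - x) / (z - y) by rewrite divr_ge0 ?subr_ge0 ?ltW// (lt_trans yx).
have t1 : (z - x) / (z - y) <= 1 by rewrite ler_pdivrMr// mul1r; lra.
have := young_convexE y z t0 t1.
have zyN0 : z - y != 0 by rewrite gt_eqF.
have -> : (z - x) / (z - y) * y + (1 - (z - x) / (z - y)) * z = x by field.
have -> : (z - x) / (z - y) * phi y + (1 - (z - x) / (z - y)) * phi z =
  ((z - x) * phi y + (x - y) * phi z) / (z - y) by field.
by rewrite ler_pdivlMr.
Qed.

(** The slope is the left derivative, the supremum of the chord slopes to the left of [x]; every
    chord slope to the right bounds it above. *)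
Lemma young_has_subgradients : has_subgradients phi.
Proof.
move=> x.
pose S := [set (phi x - phi y) / (x - y) | y in [set y | y < x]].
have ubS z : x < z -> ubound S ((phi z - phi x) / (z - x)).
  move=> xz _ [y /= yx <-]; have := young_three_points yx xz.
  have xy : 0 < x - y by rewrite subr_gt0.
  have zx : 0 < z - x by rewrite subr_gt0.
  rewrite ler_pdivrMr// mulrAC ler_pdivlMr//; lra.
have S0 : S !=set0.
  by exists ((phi x - phi (x - 1)) / (x - (x - 1))), (x - 1) => //=; lra.
have supS : has_sup S.
  split=> //; exists ((phi (x + 1) - phi x) / (x + 1 - x)); apply: ubS; lra.
exists (sup S) => y; have [yx|xy|->] := ltgtP y x.
- have : (phi x - phi y) / (x - y) <= sup S.
    by apply: ub_le_sup; [exact: supS.2|exists y].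
  by rewrite ler_pdivrMr ?subr_gt0//; lra.
- have : sup S <= (phi y - phi x) / (y - x) by apply: ge_sup => //; exact: ubS.
  by rewrite ler_pdivlMr ?subr_gt0//; lra.
- by rewrite subrr mulr0 addr0.
Qed.

Lemma young0 : phi 0 = 0.
Proof. exact/(young_eq0 yphi). Qed.

Lemma young_ge0 x : 0 <= phi x.
Proof.
have [s sP] := young_has_subgradients 0.
have := sP x; have := sP (- x); rewrite (young_even yphi) young0; lra.
Qed.

(** For [0 <= x <= y], the supporting line at [x] is evaluated at [y] if its slope is nonnegative
    and at [- y] otherwise; [phi] is even. *)
Lemma le_young (x y : R) : `|x| <= `|y| -> phi x <= phi y.
Proof.
have phi_abs z : phi z = phi `|z|.
  have [z0|z0] := leP 0 z; first by rewrite ger0_norm.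
  by rewrite ltr0_norm// (young_even yphi).
rewrite (phi_abs x) (phi_abs y).
move: `|x| (normr_ge0 x) `|y| => {}x x0 {}y xy.
have [s sP] := young_has_subgradients x.
have h1 := sP y; have := sP (- y); rewrite (young_even yphi) => h2.
have [s0|s0] := leP 0 s.
  by have : 0 <= s * (y - x) by [rewrite mulr_ge0// subr_ge0]; lra.
have : 0 <= s * (- y - x) by rewrite nmulr_rge0//; lra.
lra.
Qed.

Lemma young_le_chord (t x : R) : 0 <= t -> t <= 1 -> phi (t * x) <= t * phi x.
Proof.
move=> t0 t1; have := young_convexE x 0 t0 t1.
by rewrite young0 !mulr0 !addr0.
Qed.

(** Average the supporting line at [a + b + c] over [3 * a], [3 * b], [3 * c]: the linear terms
    cancel. *)
Lemma young_triple (a b c : R) :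
  phi (a + b + c) <= 3^-1 * (phi (3 * a) + phi (3 * b) + phi (3 * c)).
Proof.
have [s sP] := young_has_subgradients (a + b + c).
have := sP (3 * a); have := sP (3 * b); have := sP (3 * c); lra.
Qed.

Lemma measurable_young : measurable_fun setT phi.
Proof. exact: continuous_measurable_fun (young_continuous yphi). Qed.

Lemma young_superlinear_bound (A : R) : exists2 C, 0 <= C &
  forall x, 0 <= x -> A * x <= phi x + C.
Proof.
have := young_superlinear yphi => /cvgryPge/(_ A)[M [_ HM]].
exists (`|A| * `|M|); first by rewrite mulr_ge0.
move=> x x0; have [xM|Mx] := leP x `|M|.
  apply: (@le_trans _ _ (`|A| * `|M|)); last by rewrite lerDr young_ge0.
  by rewrite (le_trans (ler_norm _))// normrM ler_wpM2l// ger0_norm.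
have xpos : 0 < x by rewrite (le_lt_trans _ Mx).
have := HM x (le_lt_trans (ler_norm _) Mx); rewrite ler_pdivlMr// => AB.
by rewrite (le_trans AB)// lerDl mulr_ge0.
Qed.

Local Notation psi := (complementary phi).

(** Superlinear growth bounds the set, so that [sup] in [complementary] is a true supremum and not a
    default value. *)
Lemma complementary_has_sup (y : R) :
  has_sup [set x * `|y| - phi x | x in [set x | 0 <= x]].
Proof.
split; first by exists (0 * `|y| - phi 0), 0 => /=.
have [C C0 HC] := young_superlinear_bound `|y|.
by exists C => _ [x /= x0 <-]; have := HC x x0; lra.
Qed.

Lemma complementary_ge (y x : R) : 0 <= x -> x * `|y| - phi x <= psi y.
Proof.
move=> x0; apply: ub_le_sup; last by exists x.
exact: (complementary_has_sup y).2.
Qed.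

Lemma complementary_ge0 y : 0 <= psi y.
Proof. by have := complementary_ge y (lexx 0); rewrite mul0r young0 subrr. Qed.

Lemma le_complementary (y z : R) : `|y| <= `|z| -> psi y <= psi z.
Proof.
move=> yz; apply: ge_sup; first exact: (complementary_has_sup y).1.
move=> _ [x /= x0 <-]; rewrite (le_trans _ (complementary_ge z x0))//.
by rewrite lerB// ler_wpM2l.
Qed.

Lemma measurable_complementary : measurable_fun setT psi.
Proof.
(* The maximum with 0 extends [psi] from the half-line to a function nondecreasing on all of [R],
   hence Borel. *)
have -> : psi = (fun y => psi (Num.max y 0)) \o (fun y => `|y|).
  by apply/funext => y /=; rewrite max_l// /complementary normr_id.
apply: measurableT_comp => //; apply: nondecreasing_measurable => // x y xy.
have max0 (z : R) : 0 <= Num.max z 0 by rewrite le_max lexx orbT.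
apply: le_complementary; rewrite !ger0_norm//.
by rewrite ge_max !le_max xy lexx orbT.
Qed.

End young_theory.

(** * Modulars, Orlicz spaces and the Luxemburg norm *)

Section orlicz_theory.
Context {d : measure_display} {T : measurableType d} {R : realType}.
Variable mu : {finite_measure set T -> \bar R}.
Implicit Types (f g h : T -> R).
Local Notation igr := (Rintegrable mu).

(** Stated for any nonnegative measurable function monotone in [|x|], to serve [phi], its
    rescalings, its complementary function and the absolute value. *)
Section monotone_modular.
Variable phi : R -> R.
Hypothesis mphi : measurable_fun setT phi.
Hypothesis phi0 : forall x, 0 <= phi x.
Hypothesis phi_le : forall x y : R, `|x| <= `|y| -> phi x <= phi y.

Lemma modular_Rintegrable f : measurable_fun setT f ->
  (\int[mu]_x (phi (f x))%:E < +oo)%E -> igr (phi \o f).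
Proof.
move=> mf foo; apply/integrableP; split.
  by apply/measurable_EFinP; exact: measurableT_comp.
by under eq_integral do rewrite /= ger0_norm//.
Qed.

Lemma orlicz_Rintegrable f (C : R) : (forall x, `|x| <= phi x + C) ->
  orlicz_space mu phi f -> igr f.
Proof.
move=> phiC [mf [a a0 foo]].
have maf : measurable_fun setT (fun x => a * f x) by exact: measurable_funM.
have iphi := modular_Rintegrable maf foo.
have iaf : igr (fun x => a * f x).
  apply: (@le_Rintegrable _ _ _ _ _ (fun x => phi (a * f x) + C)) => //.
    by move=> x; rewrite (le_trans (phiC _))// ler_norm.
  apply: (@RintegrableD _ _ _ _ _ (cst C)) => //.
  exact: finite_measure_integrable_cst.
have := RintegrableZ a^-1 iaf.
congr Rintegrable; apply/funext => x; by rewrite mulKf// gt_eqF.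
Qed.

Lemma bounded_orlicz_space f (M : R) : measurable_fun setT f ->
  (forall x, `|f x| <= M) -> orlicz_space mu phi f.
Proof.
move=> mf fM; split=> //; exists 1 => //.
have i : igr (phi \o (fun x => 1 * f x)).
  apply: (@bounded_Rintegrable _ _ _ _ _ (phi M)).
    by apply: measurableT_comp => //; exact: measurable_funM.
  move=> x /=; rewrite ger0_norm// mul1r; apply: phi_le.
  by rewrite (le_trans (fM x))// ler_norm.
by rewrite -(EFin_Rint i) ltry.
Qed.

(** Dominated convergence: at each point the truncation error is eventually zero, and it never
    exceeds [f] in absolute value. *)
Lemma modular_clip_cvg0 f : phi 0 = 0 -> measurable_fun setT f ->
  (\int[mu]_x (phi (f x))%:E < +oo)%E -> forall e : R, 0 < e ->
  exists2 M : R, 0 <= M & (\int[mu]_x (phi (f x - clip M (f x)))%:E <= e%:E)%E.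
Proof.
move=> phi00 mf foo e e0.
have iphi := modular_Rintegrable mf foo.
pose u n x := (phi (f x - clip n%:R (f x)))%:E.
have mu_ n : measurable_fun setT (u n).
  apply/measurable_EFinP; apply: measurableT_comp => //.
  apply: measurable_funB => //.
  by apply: (measurableT_comp (f := clip n%:R)) => //; exact: measurable_clip.
have [||||] := @dominated_convergence _ _ _ mu setT measurableT u (cst 0%E)
  (EFin \o (phi \o f)) mu_.
- by [].
- apply: aeW => x _; apply: cvg_near_cst.
  exists (Num.bound `|f x|) => // n /= fn; rewrite /u clip_id ?subrr ?phi00//.
  have := archi_boundP (normr_ge0 (f x)) => /ltW/le_trans; apply.
  by rewrite ler_nat.
- exact: iphi.
- apply: aeW => x n _; rewrite /u /= lee_fin ger0_norm//; apply: phi_le.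
  exact: clip_contract.
- move=> _ _; rewrite integral_cst// mul0e.
  have u0 n : (0 <= \int[mu]_x u n x)%E by apply: integral_ge0 => x _; rewrite lee_fin.
  move/(ge0_cvge0P u0)/(_ _ e0) => [N _ /(_ N (leqnn N)) HN].
  by exists N%:R.
Qed.

End monotone_modular.

Lemma Rint_clip_cvg0 g : igr g -> forall e : R, 0 < e ->
  exists2 M : R, 0 <= M & \int[mu]_x `|g x - clip M (g x)| <= e.
Proof.
move=> ig e e0; have mg := Rintegrable_measurable ig.
have goo : (\int[mu]_x `|g x|%:E < +oo)%E by have /integrableP[] := ig.
have mn : measurable_fun setT (fun x : R => `|x|) by exact: normr_measurable.
have [M M0 HM] := @modular_clip_cvg0 (fun x => `|x|) mn
  (fun x => normr_ge0 x) (fun x y xy => xy) g (normr0 _) mg goo e e0.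
exists M => //; rewrite -lee_fin EFin_Rint//.
apply/Rintegrable_norm/RintegrableB => //.
apply: (@bounded_Rintegrable _ _ _ _ _ M).
  by apply: (measurableT_comp (f := clip M)) => //; exact: measurable_clip.
by move=> x; exact: clip_bound.
Qed.

Section young_modular.
Variable phi : R -> R.
Hypothesis yphi : young_function phi.

Lemma young_norm_bound : exists2 C, 0 <= C & forall x : R, `|x| <= phi x + C.
Proof.
have [C C0 HC] := young_superlinear_bound yphi 1; exists C => // x.
have := HC `|x| (normr_ge0 x); rewrite mul1r => /le_trans; apply.
by rewrite lerD2r le_young// normr_id.
Qed.

Lemma young_Rintegrable f : orlicz_space mu phi f -> igr f.
Proof.
have [C _ HC] := young_norm_bound.
exact: (orlicz_Rintegrable (measurable_young yphi) (young_ge0 yphi) HC).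
Qed.

Lemma complementary_Rintegrable f :
  orlicz_space mu (complementary phi) f -> igr f.
Proof.
(* The point 1 in the supremum defining the complementary function gives [|x| - phi 1] as a lower
   bound. *)
apply: (@orlicz_Rintegrable _ (measurable_complementary yphi)
  (complementary_ge0 yphi) _ (phi 1)).
by move=> x; have := complementary_ge yphi x ler01; rewrite mul1r lerBlDr.
Qed.

(** The constant [C = phi (2 * x0)] covers the range below the threshold [x0]. *)
Lemma Delta2_bound : Delta2 phi -> exists k C : R, [/\ 0 <= k, 0 <= C &
  forall x, phi (2 * x) <= k * phi x + C].
Proof.
move=> [k [x0 [k0 x00 H]]]; exists k, (phi (2 * x0)).
split; [exact: ltW|exact: young_ge0|] => x.
have norm2 (z : R) : `|2 * z| = 2 * `|z| by rewrite normrM ger0_norm.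
have [xx0|x0x] := leP `|x| x0.
  apply: (@le_trans _ _ (phi (2 * x0))).
    by apply: le_young => //; rewrite !norm2 ler_wpM2l// (ger0_norm (ltW x00)).
  by rewrite lerDr; apply: mulr_ge0; [exact: ltW|exact: young_ge0].
apply: (@le_trans _ _ (k * phi x)); last by rewrite lerDl young_ge0.
apply: (@le_trans _ _ (phi (2 * `|x|))).
  by apply: le_young => //; rewrite !norm2 normr_id.
rewrite (le_trans (H _ (ltW x0x)))//; apply: ler_wpM2l; first exact: ltW.
by rewrite le_young// normr_id.
Qed.

(** Doubling the scale [a] keeps the modular finite, the additive constant being integrable for a
    finite measure; enough doublings exceed [|b|]. *)
Lemma Delta2_modular_fin f (b : R) : Delta2 phi -> orlicz_space mu phi f ->
  (\int[mu]_x (phi (b * f x))%:E < +oo)%E.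
Proof.
move=> /Delta2_bound[k [C [k0 C0 HC]]] [mf [a a0 foo]].
have mphi := measurable_young yphi.
have mphib c : measurable_fun setT (fun x => phi (c * f x)).
  by apply: measurableT_comp => //; exact: measurable_funM.
have fin n : igr (fun x => phi (2 ^+ n * a * f x)).
  elim: n => [|n IH].
    rewrite expr0; under eq_fun do rewrite mul1r.
    apply: (@modular_Rintegrable _ mphi (young_ge0 yphi)) => //.
    exact: measurable_funM.
  apply: (@le_Rintegrable _ _ _ _ _ (fun x => k * phi (2 ^+ n * a * f x) + C)).
  - exact: mphib.
  - move=> x.
    have h0 : 0 <= k * phi (2 ^+ n * a * f x) + C.
      by apply: addr_ge0 => //; apply: mulr_ge0 => //; exact: young_ge0.
    rewrite (ger0_norm h0) (ger0_norm (young_ge0 yphi _)) exprS -!(mulrA 2).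
    exact: HC.
  - apply: (@RintegrableD _ _ _ _ _ (cst C)).
      exact: RintegrableZ.
    exact: finite_measure_integrable_cst.
have [n bn] : exists n : nat, `|b| <= 2 ^+ n * a.
  exists (Num.bound (`|b| / a)).
  have ba0 : 0 <= `|b| / a by rewrite divr_ge0// ltW.
  rewrite -ler_pdivrMr// (le_trans (ltW (archi_boundP ba0)))//.
  by rewrite -natrX ler_nat ltnW// ltn_expl.
have ib : igr (fun x => phi (b * f x)).
  apply: le_Rintegrable (fin n) => // x.
  rewrite !(ger0_norm (young_ge0 yphi _)); apply: (le_young yphi).
  rewrite normrM [leRHS]normrM ler_wpM2r//.
  by rewrite (le_trans bn)// ler_norm.
by rewrite -(EFin_Rint ib) ltry.
Qed.

Lemma luxemburg_norm_ge0 h : (0 <= luxemburg_norm mu phi h)%E.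
Proof.
by apply: le_ereal_inf_tmp => _ [k [k0 _] <-]; rewrite lee_fin ltW.
Qed.

Lemma luxemburg_norm_le h (k : R) : 0 < k ->
  (\int[mu]_x (phi (`|h x| / k))%:E <= 1)%E ->
  (luxemburg_norm mu phi h <= k%:E)%E.
Proof. by move=> k0 hk; apply: ereal_inf_lbound; exists k. Qed.

(** Some admissible [r] lies below [k]; integrate [|h| <= r * (phi (|h| / r) + C)]. *)
Lemma Rint_le_luxemburg_norm h (k C : R) : measurable_fun setT h ->
  0 <= C -> (forall x : R, `|x| <= phi x + C) ->
  (luxemburg_norm mu phi h < k%:E)%E ->
  igr h /\ \int[mu]_x `|h x| <= k * (1 + C * fine (mu setT)).
Proof.
move=> mh C0 HC /ereal_inf_lt[_ [r [r0 hr] <-]]; rewrite lte_fin => rk.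
have mhr : measurable_fun setT (fun x => `|h x| / r).
  by apply: measurable_funM => //; exact: measurableT_comp.
have foo := le_lt_trans hr (ltry 1).
have iphi := modular_Rintegrable (measurable_young yphi) (young_ge0 yphi) mhr foo.
have iphiC : igr (fun x => phi (`|h x| / r) + C).
  apply: (@RintegrableD _ _ _ _ _ (cst C)) => //.
  exact: finite_measure_integrable_cst.
have hle x : `|h x| <= r * (phi (`|h x| / r) + C).
  have := HC (`|h x| / r); rewrite ger0_norm; last by rewrite divr_ge0// ltW.
  by rewrite ler_pdivrMr// mulrC.
have ih : igr h.
  apply: le_Rintegrable (RintegrableZ r iphiC) => // x.
  by rewrite (le_trans (hle x))// ler_norm.
split=> //.
have K0 : 0 <= 1 + C * fine (mu setT) by rewrite addr_ge0// mulr_ge0// fine_ge0.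
rewrite (le_trans _ (ler_wpM2r K0 (ltW rk)))//.
apply: (@le_trans _ _ (\int[mu]_x (r * (phi (`|h x| / r) + C)))).
  by apply: le_Rint => //; [exact: Rintegrable_norm|exact: RintegrableZ].
rewrite RintegralZl//; apply: ler_wpM2l; first exact: ltW.
rewrite (@RintegralD _ _ _ mu _ _ (cst C))//; last first.
  exact: finite_measure_integrable_cst.
rewrite Rintegral_cst// lerD2r -lee_fin.
by rewrite (EFin_Rint iphi).
Qed.

End young_modular.
End orlicz_theory.

(** * From the two set convergences to norm convergence *)

Section norm_convergence.
Context {d : measure_display} {T : measurableType d} {R : realType}.
Variables (mu : {finite_measure set T -> \bar R}) (phi : R -> R).
Variables (An : nat -> set (set T)) (D : set (set T)).
Hypothesis yphi : young_function phi.
Hypothesis sA : forall n, sigma_subalgebra (An n).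
Hypothesis sD : sigma_subalgebra D.
Implicit Types (f g h : T -> R).
Local Notation igr := (Rintegrable mu).

(** On [[0, b * M]] the convex [phi] lies below its chord from the origin. *)
Lemma young_bounded_modular_le (b M : R) (h : T -> R) : 0 < M -> igr h ->
  {ae mu, forall x, `|h x| <= M} ->
  (\int[mu]_x (phi (b * h x))%:E <=
   (phi (b * M) / M * \int[mu]_x `|h x|)%:E)%E.
Proof.
move=> M0 ih hM; have mh := Rintegrable_measurable ih.
have K0 : 0 <= phi (b * M) / M by apply: divr_ge0; [exact: young_ge0|exact: ltW].
have inh := Rintegrable_norm ih.
rewrite -RintegralZl// EFin_Rint; last exact: RintegrableZ.
apply: ae_ge0_le_integral => //.
- by move=> x _; rewrite lee_fin young_ge0.
- apply/measurable_EFinP; apply: measurableT_comp; first exact: measurable_young.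
  exact: measurable_funM.
- by move=> x _; rewrite lee_fin mulr_ge0.
- by apply/measurable_EFinP; apply: Rintegrable_measurable; exact: RintegrableZ inh.
- apply: filterS hM => x hx _; rewrite lee_fin.
  rewrite mulrAC -mulrA [leRHS]mulrC.
  have t0 : 0 <= `|h x| / M by rewrite divr_ge0// ltW.
  have t1 : `|h x| / M <= 1 by rewrite ler_pdivrMr// mul1r.
  rewrite (le_trans _ (young_le_chord yphi _ t0 t1))//.
  apply: (le_young yphi).
  have -> : `|h x| / M * (b * M) = b * `|h x| by field; rewrite gt_eqF.
  by rewrite normrM [leRHS]normrM normr_id.
Qed.

Lemma condexp_norm_cvg f : Delta2 phi -> mu_orthogonal_convergence mu phi An D ->
  orlicz_space mu phi f ->
  luxemburg_norm mu phi (condexp mu (An n) f \- condexp mu D f)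
    @[n --> \oo] --> 0%E.
Proof.
move=> D2 [muc orth] fphi.
apply/ge0_cvge0P; first by move=> n; exact: luxemburg_norm_ge0.
move=> e e0.
have perp (A : nat -> set T) : (forall n, An n (A n)) ->
    forall g (M : R), measurable_fun setT g -> (forall x, `|g x| <= M) ->
    (\int[mu]_x (condexp_perp mu D \1_(A n) x * g x)%:E)%E
      @[n --> \oo] --> 0%E.
  move=> AnA g M mg gM; apply: orth => //.
  exact: (bounded_orlicz_space mu (measurable_complementary yphi)
    (complementary_ge0 yphi) (le_complementary yphi) mg gM).
have iF := young_Rintegrable yphi fphi.
have mf := Rintegrable_measurable iF.
(* The difference at scale [e] is split into three terms; the 3 is the factor in [young_triple]. *)
pose b := 3 / e.
have b0 : 0 < b by rewrite divr_gt0.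
pose phib x := phi (b * x).
have mphib : measurable_fun setT phib.
  by apply: measurableT_comp; [exact: measurable_young|exact: measurable_funM].
have phib0 x : 0 <= phib x by exact: (young_ge0 yphi).
have phib_le (x y : R) : `|x| <= `|y| -> phib x <= phib y.
  move=> xy; apply: (le_young yphi).
  by rewrite normrM [leRHS]normrM ler_wpM2l.
have phib_sub : has_subgradients phib.
  move=> x; have [s sP] := young_has_subgradients yphi (b * x).
  by exists (s * b) => y; rewrite -mulrA mulrBr; exact: sP.
have phib00 : phib 0 = 0 by rewrite /phib mulr0 (young0 yphi).
have phibfoo := Delta2_modular_fin yphi b D2 fphi.
have [M M0 HM] := modular_clip_cvg0 mphib phib0 phib_le phib00 mf phibfoo ltr01.
pose fM := clip M \o f; pose r := f \- fM.
have mfM : measurable_fun setT fM.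
  by apply: measurableT_comp => //; exact: measurable_clip.
have fM_le x : `|fM x| <= M by exact: clip_bound.
have ifM : igr fM by exact: bounded_Rintegrable mfM fM_le.
have ir : igr r by exact: RintegrableB.
(* By Jensen, conditioning the remainder [r] leaves its modular at most 1, whatever the
   sub-sigma-algebra. *)
have rest G : sigma_subalgebra G -> exists2 v : T -> R,
    condexp mu G f = condexp mu G fM \+ v &
    igr v /\ igr (phib \o v) /\ \int[mu]_x phib (v x) <= 1.
  move=> sG; exists (condexp mu G f \- condexp mu G fM).
    by apply/funext => x /=; rewrite addrC subrK.
  have vP := is_condexpB sG iF ifM (condexpP sG iF) (condexpP sG ifM).
  have iv := is_condexp_Rintegrable vP.
  have := le_trans (condexp_jensen sG ir vP mphib phib0 phib_sub) HM => v1.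
  have ipv := modular_Rintegrable mphib phib0 (Rintegrable_measurable iv)
    (le_lt_trans v1 (ltry 1)).
  by split=> //; split=> //; rewrite -lee_fin (EFin_Rint ipv).
have bdd G : sigma_subalgebra G ->
    {ae mu, forall x, `|condexp mu G fM x| <= M}.
  move=> sG; apply: (condexp_bounded sG ifM (condexpP sG ifM) M0).
  exact: aeW.
have iu G : sigma_subalgebra G -> igr (condexp mu G fM).
  by move=> sG; exact: is_condexp_Rintegrable (condexpP sG ifM).
(* [M + M] bounds the difference of the conditioned truncations; the 1 makes it positive. *)
pose M' := M + M + 1.
have M'0 : 0 < M' by rewrite ltr_wpDl// addr_ge0.
(* An L^1 distance of at most [(K + 1)^-1] makes the modular of the bounded part at most 1. *)
pose K := phi (b * M') / M'.
have K0 : 0 <= K by apply: divr_ge0; [exact: young_ge0|exact: ltW].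
have K10 : 0 < (K + 1)^-1 by rewrite invr_gt0 ltr_wpDl.
have := condexp_bounded_cvg sA sD perp muc mfM fM_le K10.
apply: filterS => n un.
apply: luxemburg_norm_le => //.
have [v vE [iv [ipv v1]]] := rest _ sD.
have [w wE [iw [ipw w1]]] := rest _ (sA n).
pose z := condexp mu (An n) fM \- condexp mu D fM.
have iz : igr z by apply: RintegrableB; exact: iu.
have zM : {ae mu, forall x, `|z x| <= M'}.
  apply: filterS2 (bdd _ (sA n)) (bdd _ sD) => x h1 h2.
  rewrite (le_trans (ler_normB _ _))// (le_trans (lerD h1 h2))//.
  by rewrite lerDl.
have z1 : (\int[mu]_x (phib (z x))%:E <= 1)%E.
  rewrite (le_trans (young_bounded_modular_le b M'0 iz zM))// lee_fin -/K.
  rewrite (le_trans (ler_wpM2l K0 un))// ler_pdivrMr ?ltr_wpDl// mul1r.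
  by rewrite lerDl.
have ipz := modular_Rintegrable mphib phib0 (Rintegrable_measurable iz)
  (le_lt_trans z1 (ltry 1)).
move: z1; rewrite -(EFin_Rint ipz) lee_fin => z1.
(* The difference is [z + w - v]. Each of the three modulars is at most 1, and so is their
   average. *)
have hle x : phi (`|condexp mu (An n) f x - condexp mu D f x| / e) <=
    3^-1 * (phib (z x) + phib (w x) + phib (v x)).
  rewrite vE wE /=.
  have -> : phib (v x) = phib (- v x) by rewrite /phib mulrN (young_even yphi).
  have b3 y : b * y = 3 * (y / e) by rewrite /b mulrAC mulrA.
  rewrite /phib !b3; apply: le_trans (young_triple yphi _ _ _).
  apply: (le_young yphi); rewrite -!mulrDl normrM normr_id [leRHS]normrM.
  by apply: ler_wpM2r => //; rewrite /z/= le_eqVlt; apply/orP; left; apply/eqP;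
    congr (`|_|); ring.
have isum : igr (fun x => phib (z x) + phib (w x) + phib (v x)).
  by apply: RintegrableD => //; exact: RintegrableD.
apply: (@le_trans _ _
  (\int[mu]_x (3^-1 * (phib (z x) + phib (w x) + phib (v x)))%:E)%E).
  apply: ge0_le_integral => //.
  - by move=> x _; rewrite lee_fin (young_ge0 yphi).
  - apply/measurable_EFinP; apply: measurableT_comp; first exact: measurable_young.
    apply: measurable_funM => //; apply: measurableT_comp => //.
    apply: measurable_funB; apply: (@Rintegrable_measurable _ _ _ mu).
      exact: is_condexp_Rintegrable (condexpP (sA n) iF).
    exact: is_condexp_Rintegrable (condexpP sD iF).
  - apply/measurable_EFinP.
    exact: Rintegrable_measurable (RintegrableZ 3^-1 isum).
  - by move=> x _; rewrite lee_fin; exact: hle.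
rewrite -(EFin_Rint (RintegrableZ _ isum)) lee_fin RintegralZl//.
rewrite (RintegralD measurableT (RintegrableD ipz ipw) ipv)
  (RintegralD measurableT ipz ipw).
lra.
Qed.

(** * From norm convergence to the two set convergences *)

Hypothesis norm_cvg : forall f, orlicz_space mu phi f ->
  luxemburg_norm mu phi (condexp mu (An n) f \- condexp mu D f)
    @[n --> \oo] --> 0%E.

Lemma norm_cvg_L1 f : orlicz_space mu phi f -> forall e : R, 0 < e ->
  \forall n \near \oo,
    \int[mu]_x `|condexp mu (An n) f x - condexp mu D f x| <= e.
Proof.
move=> fphi e e0; have [C C0 HC] := young_norm_bound yphi.
have iF := young_Rintegrable yphi fphi.
pose K := 1 + C * fine (mu setT).
have K0 : 0 < K by rewrite ltr_pwDl// mulr_ge0// fine_ge0.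
(* Halving turns the bound on the norm into the strict inequality with [e / K]. *)
have e'0 : 0 < e / K / 2 by rewrite !divr_gt0.
have /ge0_cvge0P/(_ _ e'0) := norm_cvg fphi.
move=> /(_ (fun n => luxemburg_norm_ge0 _ _ _)).
apply: filterS => n ne.
have := @Rint_le_luxemburg_norm _ _ _ mu _ yphi
  (condexp mu (An n) f \- condexp mu D f) (e / K) C _ C0 HC.
case.
- apply: measurable_funB; apply: (@Rintegrable_measurable _ _ _ mu).
    exact: is_condexp_Rintegrable (condexpP (sA n) iF).
  exact: is_condexp_Rintegrable (condexpP sD iF).
- by rewrite (le_lt_trans ne)// lte_fin ltr_pdivrMr// ltr_pMr ?divr_gt0// ltrDl.
- by move=> _; rewrite -/K divfK// gt_eqF.
Qed.

Let bounded_orlicz f (M : R) : measurable_fun setT f ->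
  (forall x, `|f x| <= M) -> orlicz_space mu phi f.
Proof.
exact: (bounded_orlicz_space mu (measurable_young yphi) (young_ge0 yphi)
  (le_young yphi)).
Qed.

Lemma norm_cvg_mu_convergence : mu_convergence mu An D.
Proof.
move=> B DB; have mB := subalgebra_measurable sD DB.
have m1 (C : set T) : measurable C -> measurable_fun setT (\1_C : T -> R).
  exact: measurable_indic.
have i1 (C : set T) : measurable C -> igr \1_C.
  move=> mC; exact: bounded_Rintegrable (m1 _ mC) (normr_indic_le1 C).
have cP n := condexpP (sA n) (i1 _ mB).
have AnA n : An n [set x | 2^-1 <= condexp mu (An n) \1_B x].
  by apply: sub_measurable_ge => //; have [] := cP n.
exists (fun n => [set x | 2^-1 <= condexp mu (An n) \1_B x]) => //.
apply/ge0_cvge0P; first by move=> n; exact: measure_ge0.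
move=> e e0; have e20 : 0 < e / 2 by rewrite divr_gt0.
have := norm_cvg_L1 (bounded_orlicz (m1 _ mB) (normr_indic_le1 B)) e20.
apply: filterS => n /= ce.
have mA := subalgebra_measurable (sA n) (AnA n).
rewrite -(Rint_indic_dist mu mA mB) lee_fin.
have ic := is_condexp_Rintegrable (cP n).
have cD := condexpP sD (i1 _ mB).
have iD := is_condexp_Rintegrable cD.
have i1B := i1 _ mB.
(* As [B] is in [D], [\1_B] is a version of its own conditional expectation on [D]. *)
have := condexp_unique sD i1B cD
  (is_condexp_id (sub_measurable_indic sD DB) i1B).
have := Rint_norm_triangle ic iD i1B.
have icB : igr (fun x => `|condexp mu (An n) \1_B x - \1_B x|).
  exact/Rintegrable_norm/RintegrableB.
(* Where the two indicators differ, the conditional expectation is at distance at least 1/2 from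
   [\1_B]. *)
suff : \int[mu]_x `|\1_[set x | 2^-1 <= condexp mu (An n) \1_B x] x - \1_B x : R|
    <= 2 * \int[mu]_x `|condexp mu (An n) \1_B x - \1_B x| by lra.
rewrite -RintegralZl//; apply: le_Rint.
- by apply/Rintegrable_norm/RintegrableB => //; exact: i1.
- exact: RintegrableZ.
move=> x; have -> : \1_[set x | 2^-1 <= condexp mu (An n) \1_B x] x =
    (2^-1 <= condexp mu (An n) \1_B x)%R%:R :> R.
  by rewrite indicE; congr (nat_of_bool _)%:R; exact: asboolb.
move: (condexp mu (An n) \1_B x) => c; rewrite [\1_B x]indicE; move: (x \in B) => b.
have [c2|c2] := leP 2^-1 c; case: b; rewrite /= ?subrr ?normr0 ?mulr_ge0//.
- by rewrite !subr0 normr1; have := ler_norm c; lra.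
- by rewrite sub0r normrN normr1 distrC; have := ler_norm (1 - c); lra.
Qed.

Lemma norm_cvg_orthogonal_convergence : orthogonal_convergence mu phi An D.
Proof.
move=> A AnA g gpsi.
have ig := complementary_Rintegrable yphi gpsi.
have mA n := subalgebra_measurable (sA n) (AnA n).
have perpE n : (\int[mu]_x (condexp_perp mu D \1_(A n) x * g x)%:E)%E =
    (\int[mu]_x (condexp_perp mu D \1_(A n) x * g x))%:E.
  by have [p [_ _ pE _]] := condexp_perp_version mu sD (mA n);
    rewrite /Rintegral pE.
under eq_fun do rewrite perpE.
apply/abs_cvge0P => e e0.
(* The truncation error is multiplied by the bound 2 on [p], hence the quarter. *)
have e40 : 0 < e / 4 by rewrite divr_gt0.
have [M M0 HM] := Rint_clip_cvg0 ig e40.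
pose gM := clip M \o g.
have mgM : measurable_fun setT gM.
  apply: measurableT_comp; first exact: measurable_clip.
  exact: Rintegrable_measurable ig.
have gM_le x : `|gM x| <= M by exact: clip_bound.
have igM : igr gM by exact: bounded_Rintegrable mgM gM_le.
have e20 : 0 < e / 2 by rewrite divr_gt0.
have := norm_cvg_L1 (bounded_orlicz mgM gM_le) e20.
apply: filterS => n cn.
have [p [mp p2 pE pB]] := condexp_perp_version mu sD (mA n).
have -> : \int[mu]_x (condexp_perp mu D \1_(A n) x * g x) =
    \int[mu]_x (p x * gM x) + \int[mu]_x (p x * (g x - gM x)).
  rewrite /Rintegral pE//= -[in RHS]/(Rintegral _ _ _) -[in RHS]/(Rintegral _ _ _).
  rewrite -(RintegralD measurableT); last 2 first.
  - exact: RintegrableM p2 _.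
  - by apply: RintegrableM p2 _ => //; exact: RintegrableB.
  by apply: eq_Rintegral => x _; rewrite -mulrDr addrC subrK.
have igB : igr (fun x => g x - gM x) by exact: RintegrableB.
have h2 := le_norm_RintM mp p2 igB.
have cA := condexpP (sA n) igM; have cD := condexpP sD igM.
have iA := is_condexp_Rintegrable cA; have iD := is_condexp_Rintegrable cD.
have h1 : `|\int[mu]_x (p x * gM x)| <= e / 2.
  rewrite (pB _ _ M igM M0 _ cD); last exact: aeW.
  (* Since [A n] is in [An n], [gM] may be replaced under the integral by its conditional
     expectation there. *)
  have -> : \int[mu]_x (\1_(A n) x * (gM x - condexp mu D gM x)) =
      \int[mu]_x (\1_(A n) x * (condexp mu (An n) gM x - condexp mu D gM x)).
    under eq_Rintegral do rewrite mulrBr.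
    under [RHS]eq_Rintegral do rewrite mulrBr.
    rewrite !RintegralB //; try exact: RintegrableM_indic.
    by have [_ _ ->] := (is_condexpP _ (sA n) igM).1 cA.
  have m1 : measurable_fun setT (\1_(A n) : T -> R) by exact: measurable_indic.
  have := le_norm_RintM m1 (normr_indic_le1 (A n)) (RintegrableB iA iD).
  by rewrite mul1r => /le_trans; apply.
rewrite (le_trans (ler_normD _ _))//.
move: h1 h2 HM; rewrite /gM /=; lra.
Qed.

End norm_convergence.

Theorem theorem4p4 (d : measure_display) (T : measurableType d) (R : realType)
    (mu : {finite_measure set T -> \bar R}) (phi : R -> R)
    (An : nat -> set (set T)) (D : set (set T)) :
  measure_is_complete mu ->
  young_function phi -> Delta2 phi ->
  (forall n, sigma_subalgebra (An n)) -> sigma_subalgebra D ->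
  mu_orthogonal_convergence mu phi An D <->
  (forall f : T -> R, orlicz_space mu phi f ->
    luxemburg_norm mu phi (condexp mu (An n) f \- condexp mu D f)
      @[n --> \oo] --> 0%E).
Proof.
move=> _ yphi D2 sA sD; split=> [cvgD f fphi|norm_cvg].
  exact: condexp_norm_cvg.
split; first exact: (norm_cvg_mu_convergence yphi).
exact: (norm_cvg_orthogonal_convergence yphi).
Qed.
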